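(* Let $L$ be an infinite-dimensional separable complex Hilbert space with a conjugation, and let $\mathcal F$ be the fermionic Fock space over $L$ with number operator $N$. Let $B\in B_\infty(L)$ be a bounded operator on $L$, let $1\le r<\infty$, $s=\frac{2(r-1)}{r}$, and suppose there are real constants $\gamma_r,\delta_r$ such that, on the finite-particle subspace $\mathcal F_0$, $$ d\Gamma(B)^*d\Gamma(B)\le\gamma_r N^s+\delta_r\mathbb 1 . $$ If $s=0$ (i.e. $r=1$), then $B\in B_1(L)$. If $0<s<2$, then $B\in B_{r+\varepsilon}(L)$ for all $\varepsilon>0$.
   Context: Inner products are antilinear in the first and linear in the second argument. $L$ is a separable complex Hilbert space with a conjugation $f\mapsto\bar f$ (antilinear isometric involution). Fock representation of the CAR over $L$: $\mathcal F$ is a complex Hilbert space and $f\mapsto a(f)$, $f\mapsto a^\dagger(f)$ are linear maps from $L$ into the bounded operators on $\mathcal F$ with $\{a(f),a(g)\}=0=\{a^\dagger(f),a^\dagger(g)\}$, $\{a(f),a^\dagger(g)\}=(\bar f,g)\mathbb 1$ (anticommutators), $a(f)^*=a^\dagger(\bar f)$, together with a unit vector $\Omega\in\mathcal F$ (vacuum) such that $a(f)\Omega=0$ for all $f\in L$ and the vectors $a^\dagger(f_n)\cdots a^\dagger(f_1)\Omega$ ($n\ge 0$, $f_i\in L$) span a dense subspace of $\mathcal F$. The $n$-particle space $\mathcal F^{(n)}$ is the closed span of the vectors $a^\dagger(f_n)\cdots a^\dagger(f_1)\Omega$; $\mathcal F$ is the orthogonal sum of the $\mathcal F^{(n)}$,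 $n\ge0$. $\mathcal F_0$ is the linear span of $\bigcup_n\mathcal F^{(n)}$. For a bounded operator $B$ on $L$, $d\Gamma(B):=\sum_j a^\dagger(Be_j)a(\bar e_j)$ on $\mathcal F_0$, where $\{e_j\}$ is a complete orthonormal system in $L$ (well-defined on $\mathcal F_0$, maps each $\mathcal F^{(n)}$ into itself, and $d\Gamma(B)^*=d\Gamma(B^* )$ on $\mathcal F_0$). The number operator is $N:=d\Gamma(\mathbb 1)$; $N\Phi=n\Phi$ for $\Phi\in\mathcal F^{(n)}$, and $N^s\Phi=n^s\Phi$ for $\Phi\in\mathcal F^{(n)}$, with $N^0=\mathbb 1$. $B_r(L)$, $1\le r<\infty$, is the $r$-th von Neumann-Schatten class on $L$ (compact operators with $\sum_j\mu_j^r<\infty$, $\mu_j$ the singular values); $B_\infty(L)$ is the set of all bounded operators on $L$. Operator inequalities $X\le Y$ are meant as $(\Phi,X\Phi)\le(\Phi,Y\Phi)$ for all $\Phi\in\mathcal F_0$, with $(\Phi,T^*T\Phi)=\|T\Phi\|^2$. *)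

(* Defs.v *)
From HB Require Import structures.
From mathcomp Require Import all_boot all_order all_algebra.
From mathcomp Require Import sesquilinear complex.
From mathcomp Require Import all_classical all_reals all_analysis.

Set Implicit Arguments.
Unset Strict Implicit.
Unset Printing Implicit Defensive.

Import Order.TTheory GRing.Theory Num.Theory Num.Def.
Import numFieldNormedType.Exports.

Local Open Scope classical_set_scope.
Local Open Scope ring_scope.
Local Open Scope complex_scope.

Section HilbertSpace.
Context {R : realType}.
Implicit Types H L : completeNormedModType R[i].

(* A complete normed space with a record of this type is a complex Hilbert
   space. *)
Record inner_product (H : completeNormedModType R[i]) := InnerProduct {
  ip_dot : {dot H for conjC} ;
  ip_norm : forall u : H, ip_dot u u = `|u| ^+ 2
}.

(* {dot H for conjC} is linear in its first argument and antilinear in the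
   second one; swapping them makes (f, g) antilinear in f and linear in g. *)
Definition inner H (ip : inner_product H) (f g : H) : R[i] := ip_dot ip g f.

Definition separable_space H : Prop :=
  exists2 D : set H, countable D & dense D.

Definition infinite_dimensional H : Prop :=
  forall (n : nat) (v : 'I_n -> H),
    exists f : H, forall c : 'I_n -> R[i], f <> \sum_(i < n) c i *: v i.

Record conjugation H (J : H -> H) : Prop := Conjugation {
  conj_antilinear : forall (c : R[i]) (f g : H),
    J (c *: f + g) = conjC c *: J f + J g ;
  conj_isometric : forall f : H, `|J f| = `|f| ;
  conj_involutive : involutive J
}.

Definition linear_span H (A : set H) : set H :=
  [set x | exists (n : nat) (c : 'I_n -> R[i]) (v : 'I_n -> H),
     (forall i, A (v i)) /\ x = \sum_(i < n) c i *: v i].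

Definition complete_orthonormal H (ip : inner_product H)
    (I : choiceType) (e : I -> H) : Prop :=
  (forall i j, inner ip (e i) (e j) = (i == j)%:R) /\
  (forall f, (forall i, inner ip (e i) f = 0) -> f = 0).

(* For linear maps this is boundedness in operator norm
   (linear_boundedP, linear_bounded_continuous). *)
Definition bounded_operator H (B : {linear H -> H}) : Prop :=
  bounded_near B (nbhs (0 : H)).

Definition is_adjoint H (ip : inner_product H) (T Ts : H -> H) : Prop :=
  forall f g, inner ip (T f) g = inner ip f (Ts g).

Definition compact_operator H (B : {linear H -> H}) : Prop :=
  precompact (B @` [set f : H | `|f| <= 1]).

(* mu lists the singular values of B, i.e. the nonnegative square roots of the
   eigenvalues of B^* B, repeated according to multiplicity: e is a complete
   orthonormal system of eigenvectors. The value 0 may occur in the list. The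
   index type is arbitrary so that finite and countable systems are covered. *)
Definition singular_values H (ip : inner_product H) (B : {linear H -> H})
    (I : choiceType) (mu : I -> R) : Prop :=
  exists (e : I -> H) (Bs : H -> H),
    [/\ complete_orthonormal ip e,
        is_adjoint ip B Bs,
        forall i, 0 <= mu i &
        forall i, Bs (B (e i)) = ((mu i) ^+ 2)%:C *: e i].

Definition schatten_class H (ip : inner_product H) (r : R)
    (B : {linear H -> H}) : Prop :=
  compact_operator B /\
  exists (I : choiceType) (mu : I -> R),
    singular_values ip B mu /\
    (\esum_(i in [set: I]) ((mu i) `^ r)%:E < +oo)%E.

End HilbertSpace.

Section FockSpace.
Context {R : realType} {L F : completeNormedModType R[i]}.

(* The vectors a^+(f_n) ... a^+(f_1) Om with f_1, ..., f_n in L. *)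
Definition particle_vectors (adag : L -> {linear F -> F}) (Om : F) (n : nat)
    : set F :=
  [set Phi | exists fs : n.-tuple L, Phi = foldr (fun f => adag f) Om fs].

Record fock_representation (ipL : inner_product L) (J : L -> L)
    (ipF : inner_product F) (a adag : L -> {linear F -> F}) (Om : F)
    : Prop := FockRepresentation {
  fock_a_linear : forall Phi : F, linear (fun f : L => a f Phi) ;
  fock_adag_linear : forall Phi : F, linear (fun f : L => adag f Phi) ;
  fock_a_bounded : forall f, bounded_operator (a f) ;
  fock_adag_bounded : forall f, bounded_operator (adag f) ;
  fock_car_aa : forall f g Phi, a f (a g Phi) + a g (a f Phi) = 0 ;
  fock_car_dd : forall f g Phi,
    adag f (adag g Phi) + adag g (adag f Phi) = 0 ;
  fock_car_ad : forall f g Phi,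
    a f (adag g Phi) + adag g (a f Phi) = inner ipL (J f) g *: Phi ;
  fock_adjoint : forall f, is_adjoint ipF (a f) (adag (J f)) ;
  fock_vacuum_unit : `|Om| = 1 ;
  fock_vacuum : forall f, a f Om = 0 ;
  fock_cyclic :
    dense (linear_span (\bigcup_n particle_vectors adag Om n))
}.

Definition particle_space (adag : L -> {linear F -> F}) (Om : F) (n : nat)
    : set F :=
  closure (linear_span (particle_vectors adag Om n)).

Definition finite_particle (adag : L -> {linear F -> F}) (Om : F) : set F :=
  linear_span (\bigcup_n particle_space adag Om n).

(* The series converges in norm on finite_particle, with a sum that does not
   depend on the complete orthonormal system e; lim is junk elsewhere. *)
Definition dGamma (J : L -> L) (a adag : L -> {linear F -> F})
    (e : nat -> L) (B : L -> L) (Phi : F) : F :=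
  lim (series (fun j => adag (B (e j)) (a (J (e j)) Phi)) @ \oo).

(* N = dGamma 1 is multiplication by n on the n-particle space, so N^s is
   multiplication by n^s there, extended linearly to finite_particle; Psi is determined
   by Phi in finite_particle because these spaces are mutually orthogonal.
   Since 0 `^ 0 = 1, the case s = 0 is the identity. *)
Definition number_power (adag : L -> {linear F -> F}) (Om : F) (s : R)
    (Phi : F) : F :=
  xget 0 [set Psi | exists (m : nat) (phi : nat -> F),
    [/\ forall n, particle_space adag Om n (phi n),
        Phi = \sum_(n < m) phi n &
        Psi = \sum_(n < m) ((n%:R : R) `^ s)%:C *: phi n]].

End FockSpace.

(* Main.v *)
Require Import Defs.
From HB Require Import structures.
From mathcomp Require Import all_boot all_order all_algebra.
From mathcomp Require Import sesquilinear complex.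
From mathcomp Require Import all_classical all_reals all_analysis.
From mathcomp Require Import ring lra.

Set Implicit Arguments.
Unset Strict Implicit.
Unset Printing Implicit Defensive.

Import Order.TTheory GRing.Theory Num.Theory Num.Def.
Import numFieldNormedType.Exports.

Local Open Scope classical_set_scope.
Local Open Scope ring_scope.
Local Open Scope complex_scope.

(* For orthonormal f_1, ..., f_n the Slater determinant Phi = a^+(f_1) ...
   a^+(f_n) Om is a unit vector of the n-particle space with
   (Phi, dGamma(B) Phi) = sum_k (f_k, B f_k), so the hypothesis gives
   |sum_k (f_k, B f_k)| <= K n^(1 - 1/r) for every orthonormal system.
   Choose orthonormal h_0, h_1, ... greedily, h_n nearly maximizing |(x, B x)|
   over the unit vectors x orthogonal to h_0, ..., h_(n-1), and put
   t_n = |(h_n, B h_n)|. Since all partial sums over subfamilies are controlled,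
   sum_(i < n) t_i <= 4 K n^(1 - 1/r), and by near-maximality
   t_n = O(n^(-1/r)). By polarization |B x| <= 4 t_n |x| as soon as x is
   orthogonal to the 2n vectors h_i, B^* h_i (i < n). Hence B is compact, at most
   2n singular values exceed 4 t_n, and the p-th powers of the singular values
   are summable if p > r or p = r = 1. *)

(** The hypothesis only sees sums of (f_k, B f_k) with the same vectors on both sides, whereas
    singular vectors of B come in two different families, and B is not known to be compact or
    normal. The greedy sequence replaces spectral data, and polarization with y = B x leads back to
    |B x|: both x and B x must be orthogonal to h_0, ..., h_(n-1), which is where the vectors B^*
    h_i and the count 2n come from. The exponent 1 - 1/r is s/2: |dGamma(B) Phi|^2 is of order n^s,
    and Cauchy-Schwarz against the unit vector Phi takes the square root. Summing t_n^p with t_n =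
    O(n^(-1/r)) needs p > r, whence the epsilon; for r = 1 the decay 1/n would not suffice, but
    there the partial sums of t are themselves bounded. Since [singular_values] asks for a complete
    system of eigenvectors of B^* B, the spectral theorem for compact B is proved on the way, with
    Zorn's lemma. *)

Section RealNorm.
Context {R : realType}.
Local Notation C := R[i].

(* The norm of a space over R[i] takes its values in R[i]; nm is the same norm
   with values in R, where suprema are available. *)
Definition nm {V : normedZmodType C} (x : V) : R := complex.Re `|x|.

Lemma nmE {V : normedZmodType C} (x : V) : (nm x)%:C = `|x|.
Proof. by rewrite /nm RRe_real// normr_real. Qed.

Lemma nm_ge0 {V : normedZmodType C} (x : V) : 0 <= nm x.
Proof. by rewrite -ler0c nmE. Qed.

Lemma nm0 {V : normedZmodType C} : nm (0 : V) = 0.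
Proof. by apply: complexI; rewrite nmE normr0. Qed.

Lemma nm_eq0 {V : normedZmodType C} (x : V) : (nm x == 0) = (x == 0).
Proof. by rewrite -[x == 0]normr_eq0 -nmE -(inj_eq (@complexI R)). Qed.

Lemma nm_gt0 {V : normedZmodType C} (x : V) : (0 < nm x) = (x != 0).
Proof. by rewrite lt_def nm_ge0 nm_eq0 andbT. Qed.

Lemma nmD {V : normedZmodType C} (x y : V) : nm (x + y) <= nm x + nm y.
Proof. by rewrite -lecR rmorphD /= !nmE ler_normD. Qed.

Lemma nmN {V : normedZmodType C} (x : V) : nm (- x) = nm x.
Proof. by rewrite /nm normrN. Qed.

Lemma nm_distC {V : normedZmodType C} (x y : V) : nm (x - y) = nm (y - x).
Proof. by rewrite -nmN opprB. Qed.

Lemma nmB_ge {V : normedZmodType C} (x y : V) : nm x - nm y <= nm (x - y).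
Proof. by have := nmD (x - y) y; rewrite subrK lerBlDr. Qed.

Lemma nm_sum {V : normedZmodType C} {I : finType} (P : pred I) (f : I -> V) :
  nm (\sum_(i | P i) f i) <= \sum_(i | P i) nm (f i).
Proof.
elim/big_rec2 : _ => [|i x y _ h]; first by rewrite nm0.
by rewrite (le_trans (nmD _ _))// lerD2l.
Qed.

Lemma nmM (a b : C) : nm (a * b) = nm a * nm b.
Proof. by apply: complexI; rewrite rmorphM /= !nmE normrM. Qed.

Lemma nmZ {V : normedModType C} (a : C) (x : V) : nm (a *: x) = nm a * nm x.
Proof. by apply: complexI; rewrite rmorphM /= !nmE normrZ. Qed.

Lemma nm_conj (a : C) : nm (conjC a) = nm a.
Proof. by rewrite /nm norm_conjC. Qed.

Lemma nm_real (x : R) : nm (x%:C) = `|x|.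
Proof. by apply: complexI; rewrite nmE normc_def /= expr0n /= addr0 sqrtr_sqr. Qed.

Lemma nm1 : nm (1 : C) = 1.
Proof. by rewrite -(normr1 R) -nm_real. Qed.

Lemma conjC_real (x : R) : conjC (x%:C) = x%:C :> C.
Proof. by apply: conj_Creal; apply/complex_realP; exists x. Qed.

Lemma nm_sqr (a : C) : ((nm a) ^+ 2)%:C = a * conjC a.
Proof. by rewrite rmorphXn /= nmE normCK. Qed.

Lemma abs_Re_le_nm (a : C) : `|complex.Re a| <= nm a.
Proof. by rewrite -lecR nmE normc_ge_Re. Qed.

Lemma nm_i : nm ('i%C : C) = 1.
Proof. by rewrite complexiE /nm normCi. Qed.

Lemma nm_le_ReIm (a : C) : nm a <= `|complex.Re a| + `|complex.Im a|.
Proof.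
have -> : a = (complex.Re a)%:C + 'i * (complex.Im a)%:C by rewrite -complexiE -complexE.
rewrite (le_trans (nmD _ _))// nmM !nm_real.
have -> : nm ('i : C) = 1 by rewrite /nm normCi.
rewrite mul1r -complexiE; case: a => a b /=.
by rewrite !(mul0r, mulr0, mul1r, add0r, addr0, subr0).
Qed.

Lemma abs_Im_le_nm (a : C) : `|complex.Im a| <= nm a.
Proof.
have := abs_Re_le_nm (a * - 'i); rewrite nmM nmN.
have -> : nm ('i : C) = 1 by rewrite /nm normCi.
rewrite mulr1 -complexiE; case: a => a b /=.
by rewrite !(mulr0, mulr1, mul0r, oppr0, sub0r, mulrN, opprK, add0r).
Qed.

End RealNorm.

(** * Neighborhoods, closures and limits through the real-valued norm *)

Section Topology.
Context {R : realType} {V : normedModType R[i]}.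
Local Notation C := R[i].

(** In the order of [R[i]] a positive number is real, so the epsilons of the complex-valued norm can
    be replaced by real ones. *)
Lemma posC (e : C) : 0 < e -> exists2 d : R, 0 < d & e = d%:C.
Proof.
move=> e0; exists (complex.Re e); last by rewrite RRe_real// gtr0_real.
by rewrite -ltcR RRe_real// gtr0_real.
Qed.

Lemma nbhs_nm (x : V) (A : set V) :
  nbhs x A <-> exists2 d : R, 0 < d & forall y, nm (x - y) < d -> A y.
Proof.
split.
  move/nbhs_ballP => [e /= /posC[d d0 ->] eA]; exists d => // y yd.
  by apply: eA; rewrite -ball_normE /ball_ /= -nmE ltcR.
move=> [d d0 dA]; apply/nbhs_ballP; exists d%:C => /=; first by rewrite ltcR.
by move=> y; rewrite -ball_normE /ball_ /= -nmE ltcR; apply: dA.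
Qed.

Lemma closure_nm (A : set V) (x : V) :
  closure A x <-> forall d : R, 0 < d -> exists2 y, A y & nm (x - y) < d.
Proof.
split.
  move=> clA d d0; have [] := clA [set y | nm (x - y) < d].
    by apply/nbhs_nm; exists d.
  by move=> y [Ay]; exists y.
move=> h U /nbhs_nm[d d0 dU]; have [y Ay xy] := h _ d0.
by exists y; split => //; exact: dU.
Qed.

Lemma cvg_nm (u : nat -> V) (l : V) :
  u @ \oo --> l <-> forall d : R, 0 < d ->
    exists N, forall n, (N <= n)%N -> nm (u n - l) < d.
Proof.
split.
  move=> /cvgrPdistC_lt h d d0; have := h d%:C; rewrite ltcR => /(_ d0) [N _ hN].
  by exists N => n Nn; rewrite -ltcR nmE; exact: hN.
move=> h; apply/cvgrPdistC_lt => e /posC[d d0 ->].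
have [N hN] := h _ d0; exists N => // n /= Nn.
by rewrite -nmE ltcR hN.
Qed.

End Topology.

Lemma cauchy_seq_cvg {R : realType} {V : completeNormedModType R[i]} (u : nat -> V) :
  (forall d : R, 0 < d -> exists N, forall n m, (N <= n)%N -> (N <= m)%N ->
     nm (u n - u m) < d) -> cvg (u @ \oo).
Proof.
move=> h; apply/cauchy_cvgP; apply: cauchy_exP => e /= /posC[d d0 ->].
have [N hN] := h _ d0; exists (u N); exists N => // n /= Nn.
by rewrite -ball_normE /ball_ /= -nmE ltcR hN.
Qed.

(** * Inner products: Pythagoras, Cauchy-Schwarz, passage to the limit *)

Section InnerProduct.
Context {R : realType} {H : completeNormedModType R[i]} (ip : inner_product H).
Local Notation C := R[i].
Local Notation "''[' u , v ]" := (inner ip u v) : ring_scope.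

Lemma ipDr u v w : '[u, v + w] = '[u, v] + '[u, w].
Proof. by rewrite /inner linearDl. Qed.
Lemma ipNr u v : '[u, - v] = - '[u, v].
Proof. by rewrite /inner linearNl. Qed.
Lemma ipBr u v w : '[u, v - w] = '[u, v] - '[u, w].
Proof. by rewrite ipDr ipNr. Qed.
Lemma ip0r u : '[u, 0] = 0.
Proof. by rewrite /inner linear0l. Qed.
Lemma ipZr a u v : '[u, a *: v] = a * '[u, v].
Proof. by rewrite /inner linearZl_LR. Qed.
Lemma ip_sumr (I : Type) (r : seq I) (P : pred I) u (f : I -> H) :
  '[u, \sum_(i <- r | P i) f i] = \sum_(i <- r | P i) '[u, f i].
Proof. by rewrite /inner linear_sumlz. Qed.
Lemma ipC u v : '[u, v] = conjC '[v, u].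
Proof. by rewrite /inner (hermC (ip_dot ip) v u) expr0 mul1r. Qed.
Lemma ipDl u v w : '[u + v, w] = '[u, w] + '[v, w].
Proof. by rewrite ipC ipDr rmorphD /= -!ipC. Qed.
Lemma ipNl u v : '[- u, v] = - '[u, v].
Proof. by rewrite ipC ipNr rmorphN /= -ipC. Qed.
Lemma ipBl u v w : '[u - v, w] = '[u, w] - '[v, w].
Proof. by rewrite ipDl ipNl. Qed.
Lemma ip0l u : '[0, u] = 0.
Proof. by rewrite ipC ip0r rmorph0. Qed.
Lemma ipZl a u v : '[a *: u, v] = conjC a * '[u, v].
Proof. by rewrite ipC ipZr rmorphM /= -ipC. Qed.
Lemma ip_suml (I : Type) (r : seq I) (P : pred I) u (f : I -> H) :
  '[\sum_(i <- r | P i) f i, u] = \sum_(i <- r | P i) '[f i, u].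
Proof. by rewrite ipC ip_sumr rmorph_sum; apply: eq_bigr => i _; rewrite [RHS]ipC. Qed.
Lemma ip_nm u : '[u, u] = (nm u ^+ 2)%:C.
Proof. by rewrite /inner ip_norm rmorphXn /= nmE. Qed.
Lemma ip_eq0C u v : '[u, v] = 0 -> '[v, u] = 0.
Proof. by rewrite (ipC v u) => ->; rewrite rmorph0. Qed.

Lemma addC_conj (z : C) : z + conjC z = (2 * complex.Re z)%:C.
Proof.
rewrite mulr_natl mulr2n; case: z => a b; apply/eqP.
by rewrite eq_complex /= subrr !eqxx.
Qed.

Lemma nm_sqrD u v : nm (u + v) ^+ 2 = nm u ^+ 2 + nm v ^+ 2 + 2 * complex.Re '[u, v].
Proof.
apply: complexI; rewrite -ip_nm ipDl !ipDr !ip_nm (ipC v u).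
have -> : (nm u ^+ 2 + nm v ^+ 2 + 2 * complex.Re '[u, v])%:C =
    (nm u ^+ 2)%:C + (nm v ^+ 2)%:C + (2 * complex.Re '[u, v])%:C by rewrite !rmorphD.
rewrite -addC_conj.
by rewrite -!addrA; congr (_ + _); rewrite addrC -addrA addrC -!addrA; congr (_ + _); rewrite addrC.
Qed.

Lemma nm_pyth u v : '[u, v] = 0 -> nm (u + v) ^+ 2 = nm u ^+ 2 + nm v ^+ 2.
Proof. by move=> uv; rewrite nm_sqrD uv mulr0 addr0. Qed.

Lemma cauchy_schwarz u v : nm '[u, v] <= nm u * nm v.
Proof.
have [->|u0] := eqVneq u 0; first by rewrite ip0l !nm0 mul0r.
have nu : 0 < nm u by rewrite nm_gt0.
pose a := '[u, v] / '[u, u].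
have uu : '[u, u] != 0 by rewrite ip_nm lt0r_neq0// ltcR exprn_gt0.
have h : '[a *: u, v - a *: u] = 0.
  by rewrite ipZl ipBr ipZr /a divfK// subrr mulr0.
have := nm_pyth h; rewrite addrC subrK => hv.
have : nm (a *: u) ^+ 2 <= nm v ^+ 2 by rewrite hv lerDl sqr_ge0.
rewrite ler_pXn2r// ?nnegrE ?nm_ge0// nmZ /a ip_nm nmM -(ler_pM2r nu).
rewrite -(rmorphV) /= ?unitfE ?lt0r_neq0 ?exprn_gt0// nm_real gtr0_norm ?invr_gt0 ?exprn_gt0//.
rewrite [nm v * _]mulrC; congr (_ <= _).
by field; rewrite lt0r_neq0.
Qed.

Lemma nm_small_eq (a b : C) : (forall d : R, 0 < d -> nm (a - b) < d) -> a = b.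
Proof.
move=> h; apply/eqP; rewrite -subr_eq0 -nm_eq0; apply: contraT => n0.
by have := h (nm (a - b)); rewrite ltxx lt_def n0 nm_ge0 => ->.
Qed.

Lemma ip_cvg (u : nat -> H) (l v : H) : u @ \oo --> l ->
  forall d : R, 0 < d -> exists N, forall n, (N <= n)%N -> nm ('[v, u n] - '[v, l]) < d.
Proof.
move=> /cvg_nm ul d d0.
have v1 : 0 < nm v + 1 by rewrite ltr_wpDl ?nm_ge0.
have [N hN] := ul (d / (nm v + 1)) (divr_gt0 d0 v1).
exists N => n Nn; rewrite -ipBr (le_lt_trans (cauchy_schwarz _ _))//.
rewrite (@le_lt_trans _ _ ((nm v + 1) * nm (u n - l)))//.
  by rewrite ler_wpM2r ?nm_ge0// lerDl.
by rewrite mulrC -ltr_pdivlMr// hN.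
Qed.

Lemma ip_cvg_eq (u u' : nat -> H) (l l' v v' : H) :
  u @ \oo --> l -> u' @ \oo --> l' ->
  (exists N, forall n, (N <= n)%N -> '[v, u n] = '[v', u' n]) -> '[v, l] = '[v', l'].
Proof.
move=> ul ul' [N0 e]; apply: nm_small_eq => d d0.
have d2 : 0 < d / 2 by rewrite divr_gt0.
have [N hN] := ip_cvg v ul d2; have [N' hN'] := ip_cvg v' ul' d2.
pose n := maxn N0 (maxn N N').
have := hN n; have := hN' n; have := e n.
rewrite /n !leq_max !leqnn !orbT /= => /(_ isT) en /(_ isT) h' /(_ isT) h.
have -> : '[v, l] - '[v', l'] = ('[v, l] - '[v, u n]) + ('[v', u' n] - '[v', l']).
  by rewrite {1}/n en addrA subrK.
by rewrite (le_lt_trans (nmD _ _))// [ltRHS]splitr ltrD// nm_distC.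
Qed.

Lemma ip_cvg_const (u : nat -> H) (l v : H) (a : C) :
  u @ \oo --> l -> (exists N, forall n, (N <= n)%N -> '[v, u n] = a) -> '[v, l] = a.
Proof.
move=> ul [N0 e]; apply: nm_small_eq => d d0.
have [N hN] := ip_cvg v ul d0; pose n := maxn N0 N.
have := hN n; rewrite nm_distC e ?leq_maxl//.
by rewrite nm_distC => ->//; rewrite leq_maxr.
Qed.

End InnerProduct.

Section BoundedOp.
Context {R : realType} {H : completeNormedModType R[i]} .

Lemma bounded_operatorP (B : {linear H -> H}) : bounded_operator B ->
  exists2 M : R, 0 < M & forall x, nm (B x) <= M * nm x.
Proof.
move=> /linear_boundedP /pinfty_ex_gt0[M /posC[d d0 ->] hM].
by exists d => // x; rewrite -lecR rmorphM /= !nmE.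
Qed.

Lemma bounded_cvg (B : {linear H -> H}) (u : nat -> H) (l : H) :
  bounded_operator B -> u @ \oo --> l -> (fun n => B (u n)) @ \oo --> B l.
Proof.
by move=> /linear_bounded_continuous /(_ l) cB ul; apply: cvg_comp ul cB.
Qed.
End BoundedOp.

(** * Orthonormal systems, adjoints and polarization *)

Section Orthonormal.
Context {R : realType} {H : completeNormedModType R[i]} (ip : inner_product H).
Local Notation C := R[i].
Local Notation "''[' u , v ]" := (inner ip u v) : ring_scope.

Definition orthonormal_family (I : eqType) (e : I -> H) :=
  forall i j, '[e i, e j] = (i == j)%:R.

Lemma orthonormal_comp (I I' : eqType) (e : I -> H) (g : I' -> I) :
  injective g -> orthonormal_family e -> orthonormal_family (e \o g).
Proof. by move=> gI on i j; rewrite /= on (inj_eq gI). Qed.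

Lemma orthonormal_nm (I : eqType) (e : I -> H) i :
  orthonormal_family e -> nm (e i) = 1.
Proof.
move=> on; have := on i i; rewrite ip_nm eqxx => /(@complexI R _ 1) /eqP.
by rewrite sqrf_eq1 => /orP[/eqP//|/eqP h]; have := nm_ge0 (e i); rewrite h ler0N1.
Qed.

Section FiniteFamily.
Context (I : finType) (e : I -> H) (on : orthonormal_family e).

Lemma on_ip_sum (c : I -> C) i : '[e i, \sum_j c j *: e j] = c i.
Proof.
rewrite ip_sumr (bigD1 i)//= ipZr on eqxx mulr1 big1 ?addr0// => j ji.
by rewrite ipZr on eq_sym (negbTE ji) mulr0.
Qed.

Lemma on_nm_sum (c : I -> C) : nm (\sum_j c j *: e j) ^+ 2 = \sum_j nm (c j) ^+ 2.
Proof.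
apply: complexI; rewrite -(ip_nm ip) ip_suml rmorph_sum; apply: eq_bigr => i _.
by rewrite ipZl on_ip_sum mulrC [RHS]nm_sqr.
Qed.

Lemma on_residual (f : H) i : '[e i, f - \sum_j '[e j, f] *: e j] = 0.
Proof. by rewrite ipBr on_ip_sum subrr. Qed.

Lemma bessel (f : H) : \sum_i nm '[e i, f] ^+ 2 <= nm f ^+ 2.
Proof.
set p := \sum_j '[e j, f] *: e j.
have h : '[p, f - p] = 0.
  by rewrite ip_suml big1// => i _; rewrite ipZl on_residual mulr0.
have := nm_pyth h; rewrite addrC subrK => ->.
by rewrite on_nm_sum lerDl sqr_ge0.
Qed.

End FiniteFamily.

Lemma ip_ext (u v : H) : (forall w, '[w, u] = '[w, v]) -> u = v.
Proof.
move=> h; apply/eqP; rewrite -subr_eq0 -nm_eq0 -sqrf_eq0.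
by apply/eqP; apply: complexI; rewrite -(ip_nm ip) ipBr h subrr.
Qed.

Section SequenceFamily.
Context (e : nat -> H) (on : orthonormal_family e).

Lemma on_ord n : orthonormal_family (fun i : 'I_n => e i).
Proof. by move=> i j; rewrite on. Qed.

Lemma on_ip_sum_nat (c : nat -> C) n i :
  (i < n)%N -> '[e i, \sum_(j < n) c j *: e j] = c i.
Proof. by move=> ni; exact: (on_ip_sum (@on_ord n) (fun j => c j) (Ordinal ni)). Qed.

(** By Pythagoras the squared distance of two partial sums is a difference of partial sums of
    |c_i|^2, and it is small once the earlier of these is close to their supremum. *)
Lemma on_series_cvg (c : nat -> C) (M : R) :
  (forall n, \sum_(i < n) nm (c i) ^+ 2 <= M) ->
  cvg ((fun n => \sum_(i < n) c i *: e i) @ \oo).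
Proof.
move=> cM; pose S n := \sum_(i < n) c i *: e i.
pose a n := \sum_(i < n) nm (c i) ^+ 2.
have Sa n : nm (S n) ^+ 2 = a n by exact: (on_nm_sum (@on_ord n) (fun i => c i)).
have dS N n : (N <= n)%N -> nm (S n - S N) ^+ 2 = a n - a N.
  move=> Nn; have h : '[S N, S n - S N] = 0.
    rewrite [X in '[X, _]]/S ip_suml big1// => i _.
    rewrite ipZl ipBr !on_ip_sum_nat// ?subrr ?mulr0//.
    by rewrite (leq_trans (ltn_ord i)).
  by have := nm_pyth h; rewrite addrC subrK !Sa => ->; rewrite addrAC subrr add0r.
have has : has_sup (range a).
  split; first by exists (a 0%N), 0%N.
  by exists M => _ [n _ <-]; exact: cM.
apply: cauchy_seq_cvg => d d0.
have d4 : 0 < (d / 2) ^+ 2 by rewrite exprn_gt0// divr_gt0.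
have [_ [N _ <-] hN] := sup_adherent d4 has.
have key n : (N <= n)%N -> nm (S n - S N) < d / 2.
  move=> Nn; rewrite -(ltr_pXn2r (_ : 0 < 2)%N)// ?nnegrE ?nm_ge0 ?divr_ge0 ?(ltW d0)//.
  have := sup_upper_bound has (ex_intro2 _ _ n I erefl); rewrite dS//; lra.
exists N => n m Nn Nm.
have -> : \sum_(i < n) c i *: e i - \sum_(i < m) c i *: e i = (S n - S N) + (S N - S m).
  by rewrite addrA subrK.
by rewrite (le_lt_trans (nmD _ _))// [ltRHS]splitr ltrD ?key// nm_distC key.
Qed.

Hypothesis complete : forall f, (forall i, '[e i, f] = 0) -> f = 0.

(** Bessel's inequality gives convergence; the limit has the same coefficients as f, so completeness
    identifies the two. *)
Lemma on_expand (f : H) :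
  (fun n => \sum_(i < n) '[e i, f] *: e i) @ \oo --> f.
Proof.
have /cvg_ex[l hl] : cvg ((fun n => \sum_(i < n) '[e i, f] *: e i) @ \oo).
  apply: (on_series_cvg (c := fun i => '[e i, f]) (M := nm f ^+ 2)) => n.
  exact: (bessel (@on_ord n)).
have lf : l = f; last by rewrite lf in hl.
apply/esym/eqP; rewrite -subr_eq0; apply/eqP/complete => i; rewrite ipBr.
rewrite (@ip_cvg_const _ _ ip _ l (e i) '[e i, f] hl) ?subrr//.
by exists i.+1 => n ni; rewrite (on_ip_sum_nat (fun i => '[e i, f])).
Qed.

(** The vector representing f |-> (B f, g) is assembled from its coefficients (B e_j, g). They are
    square summable because each partial sum p satisfies |p|^2 = (B p, g) <= M |p| |g|. *)
Lemma adjoint_exists (B : {linear H -> H}) :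
  bounded_operator B -> exists Bs, is_adjoint ip B Bs.
Proof.
move=> bB; have [M M0 hM] := bounded_operatorP bB.
suff /choice[Bs hBs] : forall g, exists z, forall f, '[B f, g] = '[f, z] by exists Bs.
move=> g; pose c j := '[B (e j), g].
have /cvg_ex[z hz] : cvg ((fun n => \sum_(i < n) c i *: e i) @ \oo).
  apply: (on_series_cvg (c := c) (M := (M * nm g) ^+ 2)) => n.
  pose p := \sum_(i < n) c i *: e i.
  rewrite -(on_nm_sum (@on_ord n) (fun i => c i)) -/p.
  rewrite ler_pXn2r ?nnegrE ?nm_ge0 ?mulr_ge0 ?nm_ge0 ?(ltW M0)//.
  have [->|p0] := eqVneq p 0; first by rewrite nm0 mulr_ge0 ?nm_ge0 ?(ltW M0).
  have np : 0 < nm p by rewrite nm_gt0.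
  rewrite -(ler_pM2r np) -expr2.
  have -> : nm p ^+ 2 = nm '[B p, g].
    have -> : '[B p, g] = '[p, p].
      rewrite {2}/p {1}/p linear_sum !ip_suml.
      apply: eq_bigr => i _; rewrite linearZ !ipZl.
      by rewrite (on_ip_sum (@on_ord n) (fun i => c i)).
    by rewrite ip_nm nm_real ger0_norm ?sqr_ge0.
  by rewrite (le_trans (cauchy_schwarz _ _ _))// mulrAC ler_wpM2r ?nm_ge0// hM.
exists z => f.
have ez i : '[e i, z] = c i.
  by apply: (ip_cvg_const hz); exists i.+1 => n ni; rewrite on_ip_sum_nat.
have hf := @on_expand f; have hBf := bounded_cvg bB hf.
rewrite ipC [RHS]ipC; congr (conjC _).
apply: (ip_cvg_eq hBf hf); exists 0%N => n _.
rewrite linear_sum !ip_sumr; apply: eq_bigr => i _.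
by rewrite linearZ !ipZr; congr (_ * _); rewrite ipC [RHS]ipC ez.
Qed.

End SequenceFamily.

Section Adjoint.
Context (B : {linear H -> H}) (Bs : H -> H) (adj : is_adjoint ip B Bs).

(** [is_adjoint] speaks of a bare function; its linearity follows because inner products separate
    points. *)
Lemma adjointD u v : Bs (u + v) = Bs u + Bs v.
Proof. by apply: ip_ext => w; rewrite -adj !ipDr !adj. Qed.
Lemma adjointZ a u : Bs (a *: u) = a *: Bs u.
Proof. by apply: ip_ext => w; rewrite -adj !ipZr !adj. Qed.
Lemma adjointB u v : Bs (u - v) = Bs u - Bs v.
Proof. by apply: ip_ext => w; rewrite -adj !ipBr !adj. Qed.
Lemma adjoint0 : Bs 0 = 0.
Proof. by have := adjointZ 0 0; rewrite !scale0r. Qed.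
Lemma adjoint_flip u v : '[u, B v] = '[Bs u, v].
Proof. by rewrite ipC adj -ipC. Qed.
Lemma adjoint_bound (M : R) u : 0 <= M ->
  (forall x, nm (B x) <= M * nm x) -> nm (Bs u) <= M * nm u.
Proof.
move=> M0 hM; have [->|n0] := eqVneq (nm (Bs u)) 0; first by rewrite mulr_ge0 ?nm_ge0.
have np : 0 < nm (Bs u) by rewrite lt_def n0 nm_ge0.
rewrite -(ler_pM2r np) -expr2.
have -> : nm (Bs u) ^+ 2 = nm '[B (Bs u), u].
  by rewrite adj ip_nm nm_real ger0_norm ?sqr_ge0.
by rewrite (le_trans (cauchy_schwarz _ _ _))// mulrAC ler_wpM2r ?nm_ge0// hM.
Qed.
End Adjoint.

(** Dimension count: the matrix of inner products has more rows than columns, so its left kernel is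
    nonzero. The coefficients are returned with the vector because [minmax] weighs the squared
    singular values with them. *)
Lemma exists_orthogonal n m (e : 'I_n -> H) (v : 'I_m -> H) :
  orthonormal_family e -> (m < n)%N ->
  exists2 c : 'I_n -> C, nm (\sum_i c i *: e i) = 1 &
    forall k, '[v k, \sum_i c i *: e i] = 0.
Proof.
move=> on mn; pose A : 'M[C]_(n, m) := \matrix_(i, k) '[v k, e i].
have : kermx A != 0.
  rewrite kermx_eq0 /row_free; apply: contraTneq mn => rA.
  by rewrite -leqNgt -rA rank_leq_col.
move=> /rowV0Pn[u /sub_kermxP uA u0].
pose x := \sum_i u 0 i *: e i.
have x0 : nm x != 0.
  apply: contra u0 => /eqP x0; apply/eqP/rowP => i; rewrite mxE.
  rewrite -(on_ip_sum on (fun i => u 0 i) i) -/x.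
  by move/eqP: x0; rewrite nm_eq0 => /eqP ->; rewrite ip0r.
have xs : \sum_i ((nm x)^-1%:C * u 0 i) *: e i = (nm x)^-1%:C *: x.
  by rewrite scaler_sumr; apply: eq_bigr => i _; rewrite scalerA.
exists (fun i => (nm x)^-1%:C * u 0 i); rewrite xs.
  by rewrite nmZ nm_real gtr0_norm ?mulVf// invr_gt0 lt_def x0 nm_ge0.
move=> k; rewrite ipZr ip_sumr.
have /(congr1 (fun D : 'rV_m => D 0 k)) := uA; rewrite !mxE => h.
rewrite (_ : \sum_i _ = 0) ?mulr0// -[RHS]h.
by apply: eq_bigr => i _; rewrite ipZr mxE.
Qed.

(* Polarization: 4 (y, B x) is a combination of the four values (z, B z) at
   z = y +- x and z = y +- i x. *)
Lemma polar_bound (B : {linear H -> H}) (w : R) (x y : H) :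
  (forall a b : C, nm '[a *: x + b *: y, B (a *: x + b *: y)] <=
     w * nm (a *: x + b *: y) ^+ 2) ->
  nm '[y, B x] <= w * (nm x ^+ 2 + nm y ^+ 2).
Proof.
move=> h; pose q z := '[z, B z]; pose z a := a *: x + 1 *: y.
have par a : nm a = 1 -> nm (z a) ^+ 2 + nm (z (- a)) ^+ 2 = 2 * (nm x ^+ 2 + nm y ^+ 2).
  move=> na; rewrite /z !(nm_sqrD ip) scaleNr ipNl raddfN /= mulrN nmN nmZ na mul1r scale1r; ring.
have e : '[y, B x] *+ 4 = (q (z 1) - q (z (-1))) - 'i%C * (q (z 'i%C) - q (z (- 'i%C))).
  have BD u v : B (u + v) = B u + B v by exact: linearD.
  have BZ a u : B (a *: u) = a *: B u by exact: linearZ.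
  rewrite /q /z !(BD, BZ) !(ipDl, ipDr, ipZl, ipZr).
  have ci : conjC ('i%C : C) = - 'i%C by rewrite complexiE conjCi.
  have cNi : conjC (- 'i%C : C) = 'i%C by rewrite complexiE rmorphN /= conjCi opprK.
  have cN1 : conjC (- 1 : C) = - 1 by rewrite rmorphN1.
  have c1 : conjC (1 : C) = 1 by rewrite rmorph1.
  rewrite !(ci, cNi, cN1, c1).
  have i2 : 'i%C * 'i%C = -1 :> C by rewrite -expr2 complexiE sqrCi.
  ring: i2.
have : nm ('[y, B x] *+ 4) <= w * (4 * (nm x ^+ 2 + nm y ^+ 2)).
  rewrite e (le_trans (nmD _ _))// nmN nmM nm_i mul1r.
  have p1 := par 1 nm1; have pi := par 'i%C nm_i.
  have := nmD (q (z 1)) (- q (z (-1))); have := nmD (q (z 'i%C)) (- q (z (- 'i%C))).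
  rewrite !nmN => h1 h2.
  have hz a : nm (q (z a)) <= w * nm (z a) ^+ 2 by exact: h.
  have e4 : w * (4 * (nm x ^+ 2 + nm y ^+ 2)) = (w * nm (z 1) ^+ 2 + w * nm (z (-1)) ^+ 2) +
      (w * nm (z 'i%C) ^+ 2 + w * nm (z (- 'i%C)) ^+ 2).
    by rewrite -!mulrDr p1 pi; ring.
  rewrite e4 lerD// ?(le_trans h1)// ?(le_trans h2)// lerD//; exact: hz.
have -> : '[y, B x] *+ 4 = (4 : R)%:C * '[y, B x] by rewrite rmorph_nat mulr_natl.
by rewrite nmM nm_real normr_nat [w * _]mulrCA ler_pM2l.
Qed.

Lemma polar_bound_hom (B : {linear H -> H}) (w : R) (x y : H) :
  (forall a b : C, nm '[a *: x + b *: y, B (a *: x + b *: y)] <=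
     w * nm (a *: x + b *: y) ^+ 2) ->
  nm '[y, B x] <= 2 * w * nm x * nm y.
Proof.
move=> h.
have [->|x0] := eqVneq x 0; first by rewrite linear0 ip0r !nm0 mulr0 mul0r.
have [->|y0] := eqVneq y 0; first by rewrite ip0l !nm0 mulr0.
have nx : 0 < nm x by rewrite nm_gt0.
have ny : 0 < nm y by rewrite nm_gt0.
(* Rescaling x by |y| and y by |x| gives both vectors the norm |x| |y|, which turns the sum of
   squares of [polar_bound] into a product. *)
have /polar_bound : forall a b : C,
    let z := a *: ((nm y)%:C *: x) + b *: ((nm x)%:C *: y) in
    nm '[z, B z] <= w * nm z ^+ 2.
  by move=> a b; rewrite !scalerA; exact: h.
rewrite linearZ ipZl ipZr conjC_real !nmM !nmZ !nm_real !gtr0_norm// => k.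
have nxy : 0 < nm x * nm y by rewrite mulr_gt0.
rewrite -(ler_pM2l nxy) -[X in X <= _]mulrA (le_trans k)//.
by rewrite le_eqVlt; apply/orP; left; apply/eqP; ring.
Qed.

End Orthonormal.

(** * Inequalities for finite sums *)

Section RealSums.
Context {R : realType}.
Local Notation C := R[i].

(** Each greedy vector costs two orthogonality conditions, so the k-th singular value is compared
    with the greedy value of index [k./2]; every index is then hit twice. *)
Lemma sum_half (f : nat -> R) N : (forall n, 0 <= f n) ->
  \sum_(k < N) f k./2 <= 2 * \sum_(j < N) f j.
Proof.
move=> f0; have e : \sum_(k < N.*2) f k./2 = 2 * \sum_(j < N) f j.
  elim: N => [|N IH]; first by rewrite !big_ord0 mulr0.
  rewrite doubleS !big_ord_recr /= IH uphalf_double half_double; ring.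
rewrite -e -(big_mkord xpredT (fun k => f k./2)) -(big_mkord xpredT (fun k => f k./2)).
have NN : (N <= N.*2)%N by rewrite -addnn leq_addr.
by rewrite [leRHS](big_cat_nat (leq0n _) NN)//= lerDl sumr_ge0.
Qed.

(** Cauchy condensation: the block 2^m <= j + 1 < 2^(m+1) has 2^m terms, each at most 2^(-m a),
    hence total at most q^m with q = 2^(1 - a) < 1. *)
Lemma riemann_sum_bound (a : R) : 1 < a ->
  exists M : R, forall N, \sum_(j < N) (j.+1%:R `^ (- a)) <= M.
Proof.
move=> a1; pose q : R := 2 `^ (1 - a).
have q0 : 0 <= q by exact: powR_ge0.
have q1 : q < 1.
  rewrite /q -opprB powRN invf_lt1 ?powR_gt0//.
  have : 1 `^ (a - 1) < 2 `^ (a - 1) :> R by rewrite gt0_ltr_powR ?nnegrE ?subr_gt0 ?ltr1n.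
  by rewrite powR1.
have dy m : \sum_(0 <= j < (2 ^ m).-1) (j.+1%:R `^ (- a)) <= \sum_(i < m) q ^+ i.
  elim: m => [|m IH]; first by rewrite expn0 big_geq// big_ord0.
  have lem : ((2 ^ m).-1 <= (2 ^ m.+1).-1)%N by rewrite -!subn1 leq_sub2r// leq_exp2l.
  rewrite (big_cat_nat (leq0n _) lem)//= big_ord_recr lerD//=.
  have p2 : (0 < 2 ^ m)%N by rewrite expn_gt0.
  apply: (@le_trans _ _ (\sum_((2 ^ m).-1 <= j < (2 ^ m.+1).-1) (2 ^ m)%:R `^ (- a))).
    rewrite big_nat [leRHS]big_nat ler_sum// => j /andP[mj _].
    rewrite !powRN lef_pV2 ?posrE ?powR_gt0 ?ltr0n//.
    rewrite ge0_ler_powR ?nnegrE ?ler0n ?ler_nat//; first by lra.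
    by rewrite -(prednK p2).
  rewrite sumr_const_nat.
  have -> : ((2 ^ m.+1).-1 - (2 ^ m).-1 = 2 ^ m)%N.
    by rewrite expnS; case: (2 ^ m)%N p2 => // k _; rewrite mul2n -addnn addSn /= addKn.
  rewrite -[X in X <= _]mulr_natl; set y : R := (2 ^ m)%:R.
  have y0 : y != 0 by rewrite pnatr_eq0 -lt0n.
  have <- : y `^ (1 - a) = y * y `^ (- a).
    by rewrite powRD ?powRr1 ?ler0n// y0 implybT.
  by rewrite /y natrX -powR_mulrn// -powRrM mulrC powRrM powR_mulrn.
have geo m : \sum_(i < m) q ^+ i <= (1 - q)^-1.
  have := subrX1 q m => e; rewrite -(ler_pM2l (_ : 0 < 1 - q)) ?subr_gt0//.
  rewrite divff ?subr_eq0 ?gt_eqF//; have := exprn_ge0 m q0; lra.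
exists (1 - q)^-1 => N; apply: (le_trans _ (geo N)); apply: (le_trans _ (dy N)).
rewrite -(big_mkord xpredT (fun j => j.+1%:R `^ (- a))).
have NN : (N <= (2 ^ N).-1)%N by rewrite -ltnS prednK ?expn_gt0// ltn_expl.
by rewrite [leRHS](big_cat_nat (leq0n _) NN)//= lerDl sumr_ge0// => j _; exact: powR_ge0.
Qed.

(** Nothing cancels within the set of nonnegative terms, nor within its complement; each of the two
    accounts for one D. *)
Lemma abs_sum_le n (x : 'I_n -> R) (D : R) :
  (forall A : {set 'I_n}, `|\sum_(i in A) x i| <= D) -> \sum_i `|x i| <= 2 * D.
Proof.
move=> h; pose A := [set i | 0 <= x i]%SET.
rewrite (bigID (mem A))/= mulrDl mul1r lerD//.
  rewrite (le_trans _ (h A))// (le_trans _ (ler_norm _))// le_eqVlt; apply/orP; left.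
  by apply/eqP; apply: eq_bigr => i; rewrite inE => /ger0_norm.
rewrite (le_trans _ (h (~: A)))// -normrN (le_trans _ (ler_norm _))// -sumrN.
rewrite le_eqVlt; apply/orP; left; apply/eqP; apply: eq_big => i; first by rewrite !inE.
by rewrite inE -ltNge => /ltr0_norm.
Qed.

(** Control of all subsums rules out cancellation. The factor 4 is two signs times real and
    imaginary part. *)
Lemma nm_sum_le n (z : 'I_n -> C) (D : R) :
  (forall A : {set 'I_n}, nm (\sum_(i in A) z i) <= D) -> \sum_i nm (z i) <= 4 * D.
Proof.
move=> h.
have Res (A : {set 'I_n}) : complex.Re (\sum_(i in A) z i) = \sum_(i in A) complex.Re (z i).
  by elim/big_rec2 : _ => // i x y _ <-; case: (z i) y => a b [].
have Ims (A : {set 'I_n}) : complex.Im (\sum_(i in A) z i) = \sum_(i in A) complex.Im (z i).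
  by elim/big_rec2 : _ => // i x y _ <-; case: (z i) y => a b [].
have h1 : \sum_i `|complex.Re (z i)| <= 2 * D.
  by apply: abs_sum_le => A; rewrite -Res (le_trans (abs_Re_le_nm _)).
have h2 : \sum_i `|complex.Im (z i)| <= 2 * D.
  by apply: abs_sum_le => A; rewrite -Ims (le_trans (abs_Im_le_nm _)).
apply: (@le_trans _ _ (\sum_i (`|complex.Re (z i)| + `|complex.Im (z i)|))).
  by apply: ler_sum => i _; exact: nm_le_ReIm.
by rewrite big_split /=; lra.
Qed.

(** This takes the place of sorting [mu]: among k + 1 distinct indices one has value at most
    [tau k]; it is paired with the last term on the right and removed. *)
Lemma sum_powR_le (I : eqType) (mu : I -> R) (tau : nat -> R) (p : R) (s : seq I) :
  0 <= p -> (forall i, 0 <= mu i) ->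
  (forall k (g : 'I_k.+1 -> I), injective g -> exists j, mu (g j) <= tau k) ->
  uniq s -> \sum_(i <- s) mu i `^ p <= \sum_(k < size s) tau k `^ p.
Proof.
move=> p0 mu0 h; move: {-2}(size s) (erefl (size s)) => k.
elim: k s => [|k IH] s sk us.
  by move/esym/size0nil: sk => ->; rewrite big_nil big_ord0.
case: s sk us => // x0 s0; set s := x0 :: s0 => sk us.
have gI : injective (fun i : 'I_k.+1 => nth x0 s i).
  move=> i j /eqP; rewrite nth_uniq -?sk// => /eqP; exact: val_inj.
have [j hj] := h k _ gI; set y := nth x0 s j in hj.
have ys : y \in s by rewrite mem_nth -?sk.
rewrite (perm_big _ (perm_to_rem ys)) big_cons big_ord_recr [leRHS]addrC lerD//; last first.
  by rewrite IH ?rem_uniq// size_rem// -sk.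
by rewrite ge0_ler_powR ?nnegrE// (le_trans (mu0 y)).
Qed.

End RealSums.

(** * The greedy orthonormal sequence and the decay of its diagonal values *)

Section Greedy.
Context {R : realType} {H : completeNormedModType R[i]} (ip : inner_product H).
Local Notation C := R[i].
Local Notation "''[' u , v ]" := (inner ip u v) : ring_scope.
Context (B : {linear H -> H}) (B_bounded : bounded_operator B).

(** The supremum need not be attained, hence the factor 2. The system [e] supplies arbitrarily many
    orthonormal vectors, so that unit vectors orthogonal to [s] always exist. *)
Lemma greedy_step (e : nat -> H) (s : seq H) : orthonormal_family ip e ->
  exists h, [/\ nm h = 1, {in s, forall v, '[v, h] = 0} &
    forall x, nm x = 1 -> {in s, forall v, '[v, x] = 0} ->
      nm '[x, B x] <= 2 * nm '[h, B h]].
Proof.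
move=> on; have [M M0 hM] := bounded_operatorP B_bounded.
pose P := [set x : H | nm x = 1 /\ {in s, forall v, '[v, x] = 0}].
pose D := [set nm '[x, B x] | x in P].
have [x0 [nx0 Px0]] : P !=set0.
  have [c n1 co] := exists_orthogonal (fun i : 'I_(size s) => nth 0 s i)
    (on_ord on (n := (size s).+1)) (ltnSn _).
  exists (\sum_i c i *: e i); split => // v vs.
  have iv : (index v s < size s)%N by rewrite index_mem.
  by have := co (Ordinal iv); rewrite /= nth_index.
have hs : has_sup D.
  split; first by exists (nm '[x0, B x0]), x0.
  exists M => _ [x [nx _] <-]; rewrite (le_trans (cauchy_schwarz _ _ _))// nx mul1r.
  by rewrite (le_trans (hM _))// nx mulr1.
have ub x : P x -> nm '[x, B x] <= sup D.
  by move=> Px; apply: (sup_upper_bound hs); exists x.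
(* If the supremum is not positive, every admissible value is 0 and any admissible unit vector will
   do; otherwise half the supremum is a legitimate tolerance. *)
have [s0|s0] := leP (sup D) 0.
  exists x0; split => // x nx xs.
  by rewrite (le_trans (ub x _))// (le_trans s0)// mulr_ge0 ?nm_ge0.
have s2 : 0 < sup D / 2 by rewrite divr_gt0.
have [_ [h [nh hP] <-] hh] := sup_adherent s2 hs.
exists h; split => // x nx xs.
have := ub x (conj nx xs); lra.
Qed.

Lemma greedy_sequence (e : nat -> H) : orthonormal_family ip e ->
  exists2 h : nat -> H, orthonormal_family ip h &
    forall n x, nm x = 1 -> (forall i, (i < n)%N -> '[h i, x] = 0) ->
      nm '[x, B x] <= 2 * nm '[h n, B (h n)].
Proof.
move=> on.
have /choice[next hnext] := fun s => greedy_step s on.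
(* Each choice depends on all earlier vectors, so the recursion runs on the list of vectors chosen
   so far. *)
pose hs := fix hs n := if n is m.+1 then rcons (hs m) (next (hs m)) else [::].
pose h n := next (hs n).
have hsE n : hs n = [seq h i | i <- iota 0 n].
  by elim: n => // n IH; rewrite -[in RHS]addn1 iotaD map_cat -IH /= cats1.
have ho i j : (i < j)%N -> '[h i, h j] = 0.
  move=> ij; have [_ + _] := hnext (hs j); apply.
  by rewrite hsE map_f// mem_iota.
exists h.
  move=> i j; have [ij|ji|->] := ltngtP i j.
  - by rewrite ho.
  - by rewrite (ip_eq0C (ho _ _ ji)).
  - by rewrite ip_nm; have [-> _ _] := hnext (hs j); rewrite expr1n.
move=> n x nx xo; have [_ _] := hnext (hs n); apply => // v.
elim: n xo => [|n IH] xo; first by rewrite in_nil.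
rewrite [hs _]/= mem_rcons inE => /orP[/eqP ->|]; first by rewrite -/(h n) xo.
by apply: IH => i ni; rewrite xo// ltnW.
Qed.

Context (Bs : H -> H) (adj : is_adjoint ip B Bs).
Context (h : nat -> H) (on_h : orthonormal_family ip h).
Hypothesis greedy : forall n x, nm x = 1 -> (forall i, (i < n)%N -> '[h i, x] = 0) ->
  nm '[x, B x] <= 2 * nm '[h n, B (h n)].
Let t n := nm '[h n, B (h n)].

(** Polarization is applied to the pair x, B x. Orthogonality of x to B^* h_i says that B x is
    orthogonal to h_i, so the whole span of x and B x is admissible at step n. The 4 is 2 from
    near-maximality times 2 from polarization. *)
Lemma tail_bound n x : (forall i, (i < n)%N -> '[h i, x] = 0) ->
  (forall i, (i < n)%N -> '[Bs (h i), x] = 0) -> nm (B x) <= 4 * t n * nm x.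
Proof.
move=> hx hBx.
have unit z : (forall i, (i < n)%N -> '[h i, z] = 0) ->
    nm '[z, B z] <= 2 * t n * nm z ^+ 2.
  move=> hz; have [->|z0] := eqVneq z 0; first by rewrite ip0l !nm0 expr0n mulr0.
  have nz : 0 < nm z by rewrite nm_gt0.
  have := @greedy n ((nm z)^-1%:C *: z).
  rewrite nmZ nm_real gtr0_norm ?invr_gt0// mulVf ?gt_eqF// => /(_ erefl).
  have uz : forall i, (i < n)%N -> '[h i, (nm z)^-1%:C *: z] = 0.
    by move=> i ni; rewrite ipZr hz// mulr0.
  move=> /(_ uz); rewrite linearZ ipZl ipZr conjC_real !nmM !nm_real gtr0_norm ?invr_gt0//.
  by rewrite mulrA -invfM -expr2 mulrC ler_pdivrMr ?exprn_gt0.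
have [->|Bx0] := eqVneq (nm (B x)) 0; first by rewrite !mulr_ge0 ?nm_ge0.
have nB : 0 < nm (B x) by rewrite lt_def Bx0 nm_ge0.
have := @polar_bound_hom _ _ ip B (2 * t n) x (B x).
rewrite ip_nm nm_real ger0_norm ?sqr_ge0// => k.
rewrite -(ler_pM2r nB) -expr2 (le_trans (k _))//.
  move=> a b; apply: unit => i ni.
  by rewrite ipDr !ipZr hx// (adjoint_flip adj) hBx// !mulr0 addr0.
by rewrite !mulrA (_ : 2 * 2 = 4 :> R)//; ring.
Qed.

(** A min-max argument: some unit combination x of 2n + 1 eigenvectors is orthogonal to the n
    vectors h_i and the n vectors B^* h_i. If all their singular values exceeded 4 t_n, so would |B
    x|, against [tail_bound]. *)
Lemma minmax (I : eqType) (u : I -> H) (mu : I -> R) n (g : 'I_n.*2.+1 -> I) :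
  orthonormal_family ip u -> (forall i, 0 <= mu i) ->
  (forall i, Bs (B (u i)) = (mu i ^+ 2)%:C *: u i) ->
  injective g -> exists k, mu (g k) <= 4 * t n.
Proof.
move=> on_u mu0 hmu gI; apply: contrapT => /forallNP big.
have {}big k : 4 * t n < mu (g k) by rewrite ltNge; apply/negP.
pose v (j : 'I_n.*2) := if (j < n)%N then h j else Bs (h (j - n)%N).
have [c n1 co] := exists_orthogonal v (orthonormal_comp gI on_u) (ltnSn _).
set x := \sum_i _ in n1 co.
have t0 : 0 <= 4 * t n by rewrite mulr_ge0 ?nm_ge0.
have : nm (B x) <= 4 * t n.
  have := @tail_bound n x; rewrite n1 mulr1; apply => i ni.
    have i2 : (i < n.*2)%N by rewrite -addnn ltn_addr.
    by have := co (Ordinal i2); rewrite /v /= ni.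
  have i2 : (n + i < n.*2)%N by rewrite -addnn ltn_add2l.
  by have := co (Ordinal i2); rewrite /v /= ltnNge leq_addr /= addKn.
rewrite -(ler_pXn2r (_ : 0 < 2)%N)// ?nnegrE ?nm_ge0//.
apply/negP; rewrite -ltNge.
have -> : nm (B x) ^+ 2 = \sum_i nm (c i) ^+ 2 * mu (g i) ^+ 2.
  apply: complexI; rewrite -(ip_nm ip) adj.
  have -> : Bs (B x) = \sum_i (c i * (mu (g i) ^+ 2)%:C) *: (u \o g) i.
    rewrite /x linear_sum.
    have -> : Bs (\sum_i B (c i *: (u \o g) i)) = \sum_i Bs (B (c i *: (u \o g) i)).
      elim/big_rec2 : _ => [|i y z _ <-]; last exact: (adjointD adj).
      exact: (adjoint0 adj).
    by apply: eq_bigr => i _; rewrite linearZ (adjointZ adj) hmu scalerA.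
  rewrite ip_suml rmorph_sum; apply: eq_bigr => i _.
  rewrite ipZl (on_ip_sum (orthonormal_comp gI on_u)) mulrA [conjC _ * _]mulrC -nm_sqr.
  by rewrite [RHS]rmorphM.
have -> : (4 * t n) ^+ 2 = \sum_i nm (c i) ^+ 2 * (4 * t n) ^+ 2.
  by rewrite -mulr_suml -(on_nm_sum (orthonormal_comp gI on_u)) -/x n1 expr1n mul1r.
(* The termwise comparison is strict only where the coefficient is nonzero, so one such index is
   isolated. *)
have [i ci] : exists i, c i != 0.
  apply: contrapT => /forallNP c0; have := n1; rewrite /x big1 ?nm0; last first.
    by move=> i _; have /negP := c0 i; rewrite negbK => /eqP ->; rewrite scale0r.
  by move/eqP; rewrite eq_sym oner_eq0.
have le k : nm (c k) ^+ 2 * (4 * t n) ^+ 2 <= nm (c k) ^+ 2 * mu (g k) ^+ 2.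
  rewrite ler_wpM2l ?sqr_ge0// ler_pXn2r ?nnegrE ?mu0//; exact/ltW.
rewrite (bigD1 i)//= [ltRHS](bigD1 i)//= ltr_leD//; last by apply: ler_sum => k _; exact: le.
rewrite ltr_pM2l ?exprn_gt0 ?nm_gt0// ltr_pXn2r ?nnegrE ?mu0//.
Qed.

Section Decay.
Context (K alpha : R) (K0 : 0 <= K) (alpha0 : 0 <= alpha).
Hypothesis quad : forall n (f : 'I_n -> H), orthonormal_family ip f ->
  nm (\sum_i '[f i, B (f i)]) <= K * n%:R `^ alpha.

Lemma sum_t_le n : \sum_(i < n) t i <= 4 * (K * n%:R `^ alpha).
Proof.
apply: (@nm_sum_le _ _ (fun i : 'I_n => '[h i, B (h i)])) => A.
rewrite big_enum_val/=.
have gI : injective (fun i : 'I_#|A| => val (enum_val i)).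
  by move=> i j /val_inj /enum_val_inj.
rewrite (le_trans (quad (orthonormal_comp gI on_h)))// ler_wpM2l//.
by rewrite ge0_ler_powR ?nnegrE ?ler0n// ler_nat -[leqRHS]card_ord max_card.
Qed.

(** The later vector [h n] is orthogonal to h_0, ..., h_(m-1) and therefore already competed at step
    m. *)
Lemma t_quasi m n : (m <= n)%N -> t n <= 2 * t m.
Proof.
move=> mn; apply: greedy; first exact: (orthonormal_nm n on_h).
move=> i im; rewrite on_h; have [e|//] := eqVneq i n.
by move: (leq_trans im mn); rewrite e ltnn.
Qed.

(** As [t] is decreasing up to a factor 2, (n + 1) t_n is at most twice the sum of t_0, ..., t_n;
    with the 4 of [sum_t_le] this makes 8. *)
Lemma t_decay n : t n <= 8 * K * n.+1%:R `^ (alpha - 1).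
Proof.
have n0 : 0 < n.+1%:R :> R by rewrite ltr0n.
rewrite powRB; last by apply/implyP => _; rewrite gt_eqF.
rewrite powRr1 ?ler0n// mulrA ler_pdivlMr//.
have -> : t n * n.+1%:R = \sum_(i < n.+1) t n.
  by rewrite sumr_const card_ord mulr_natr.
apply: (@le_trans _ _ (\sum_(i < n.+1) 2 * t i)).
  by apply: ler_sum => i _; apply: t_quasi; rewrite -ltnS.
rewrite -mulr_sumr; have := sum_t_le n.+1; lra.
Qed.

(** For r = p = 1 the exponent [alpha] is 0 and [sum_t_le] is already a uniform bound. For p > r the
    decay of [t] gives the exponent (alpha - 1) p = -p/r < -1. *)
Lemma tau_summable (r p : R) : 1 <= r -> alpha = 1 - r^-1 ->
  (r = 1 /\ p = 1) \/ r < p ->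
  exists M, forall N, \sum_(k < N) (4 * t k./2) `^ p <= M.
Proof.
move=> r1 ea rp.
have p0 : 0 <= p by case: rp => [[_ ->]//|]; lra.
have t0 n : 0 <= t n by exact: nm_ge0.
suff [M hM] : exists M, forall N, \sum_(j < N) (4 * t j) `^ p <= M.
  exists (2 * M) => N.
  rewrite (le_trans (sum_half (f := fun j => (4 * t j) `^ p) N _))//.
    by move=> n; exact: powR_ge0.
  by rewrite ler_pM2l.
case: rp => [[er ep]|rp].
  exists (4 * (4 * K)) => N; rewrite ep.
  under eq_bigr do rewrite powRr1 ?mulr_ge0//.
  rewrite -mulr_sumr ler_pM2l//; have := sum_t_le N.
  by rewrite ea er invr1 subrr powRr0 mulr1.
have r0 : 0 < r by lra.
have a1 : 1 < p / r by rewrite ltr_pdivlMr// mul1r.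
have [M hM] := riemann_sum_bound a1.
exists ((4 * (8 * K)) `^ p * M) => N.
apply: (@le_trans _ _ (\sum_(j < N) (4 * (8 * K)) `^ p * (j.+1%:R `^ (- (p / r))))).
  apply: ler_sum => j _.
  have -> : - (p / r) = (alpha - 1) * p by rewrite ea; ring.
  rewrite powRrM -powRM ?powR_ge0 ?mulr_ge0//.
  rewrite ge0_ler_powR ?nnegrE ?mulr_ge0 ?powR_ge0//.
  by rewrite -mulrA ler_pM2l// t_decay.
by rewrite -mulr_sumr ler_wpM2l ?powR_ge0.
Qed.

End Decay.
End Greedy.

(** * Precompactness from finite partitions *)

Section TotallyBounded.
Context {R : realType} {V : completeNormedModType R[i]}.

(** An ultrafilter on the closure of the image contains, for one of the finitely many cells, the set
    of points near the image of that cell. As these sets have small diameter the ultrafilter is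
    Cauchy, and completeness gives its limit. *)
Lemma finite_cells_precompact (X : Type) (S : set X) (f : X -> V) :
  (forall d : R, 0 < d -> exists (T : finType) (phi : X -> T),
     forall x y, S x -> S y -> phi x = phi y -> nm (f x - f y) <= d) ->
  precompact (f @` S).
Proof.
move=> h; rewrite precompactE compact_ultra /= => F UF FA.
have cF : cauchy F.
  apply: cauchy_exP => e /= /posC[d d0 ->].
  have d4 : 0 < d / 4 by rewrite divr_gt0.
  have [T [phi hphi]] := h _ d4.
  pose U c := [set y | exists p, [/\ S p, phi p = c & nm (y - f p) < d / 4]].
  have [c Fc] : exists c, F (U c).
    apply: contrapT => /forallNP nF.
    have /(@filter_forall _ _ _ _ _) nF' : forall c, F (~` U c).
      by move=> c; have [/nF|] := in_ultra_setVsetC (U c) UF.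
    have [y [/closure_nm cy ny]] := filter_ex (filterI FA nF').
    have [_ [p Sp <-] yp] := cy _ d4.
    by apply: (ny (phi p)); exists p.
  have [y0 [p0 [Sp0 e0 _]]] := filter_ex Fc.
  exists (f p0); apply: filterS Fc => y [p [Sp ep yp]].
  rewrite -ball_normE /ball_ /= -nmE ltcR nm_distC -[y](subrK (f p)) -addrA.
  have := hphi _ _ Sp Sp0 (etrans ep (esym e0)).
  by have := nmD (y - f p) (f p - f p0); lra.
have Fl : F --> lim F by exact: cauchy_cvg.
exists (lim F); split => //.
rewrite (closure_id (closure _)).1; last exact: closed_closure.
by move=> U Ul; apply: (filter_ex (F := F)); apply: filterI => //; exact: (Fl U Ul).
Qed.

End TotallyBounded.

Lemma real_grid {R : realType} (eta : R) : 0 < eta -> exists K (cell : R -> 'I_K.+1),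
  forall x y, `|x| <= 1 -> `|y| <= 1 -> cell x = cell y -> `|x - y| <= eta.
Proof.
move=> eta0; pose K := Num.truncn (2 / eta).
(* Points outside [-1, 1] may fall into a default cell of [truncn] or [inord], so the conclusion is
   restricted to that interval. *)
pose cell (x : R) : 'I_K.+1 := inord (Num.truncn ((x + 1) / eta)).
have itv x : `|x| <= 1 -> (nat_of_ord (cell x))%:R <= (x + 1) / eta /\
    (x + 1) / eta < (nat_of_ord (cell x))%:R + 1.
  rewrite ler_norml => /andP[x1 x2].
  have y0 : 0 <= (x + 1) / eta by rewrite divr_ge0 ?(ltW eta0)//; lra.
  have := truncn_itv y0 => /andP[h1 h2].
  rewrite /cell inordK; first by rewrite natr1.
  by rewrite ltnS le_truncn// ler_pM2r ?invr_gt0//; lra.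
exists K, cell => x y /itv[x1 x2] /itv[y1 y2] e; rewrite e in x1 x2.
have : `|(x + 1) / eta - (y + 1) / eta| <= 1 by rewrite ler_norml; lra.
rewrite -mulrBl normrM (gtr0_norm (_ : 0 < eta^-1)) ?invr_gt0// ler_pdivrMr// mul1r.
by rewrite opprD addrACA subrr addr0.
Qed.

(** * Compactness from small tails, and the spectral decomposition of B^* B *)

Section CompactOperators.
Context {R : realType} {H : completeNormedModType R[i]} (ip : inner_product H).
Local Notation C := R[i].
Local Notation "''[' u , v ]" := (inner ip u v) : ring_scope.

(** Only the orthogonal complement is tracked: a vector whose residual vanishes adds nothing, any
    other adds one index through [option]. *)
Lemma gram_schmidt (s : seq H) : exists (I : finType) (u : I -> H),
  orthonormal_family ip u /\
  forall x, (forall i, '[u i, x] = 0) -> {in s, forall v, '[v, x] = 0}.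
Proof.
elim: s => [|v s [I [u [on hu]]]].
  by exists 'I_0, (fun _ => 0); split; [case | move=> x _ v; rewrite in_nil].
pose p := \sum_i '[u i, v] *: u i.
have vp x : '[v, x] = '[v - p, x] + '[p, x] by rewrite ipBl subrK.
have px x : (forall i, '[u i, x] = 0) -> '[p, x] = 0.
  by move=> h; rewrite ip_suml big1// => i _; rewrite ipZl h mulr0.
have [vp0|vp0] := eqVneq (v - p) 0.
  exists I, u; split => // x h w; rewrite inE => /orP[/eqP ->|]; last exact: hu.
  by rewrite vp vp0 ip0l px// addr0.
have n0 : 0 < nm (v - p) by rewrite nm_gt0.
pose w := (nm (v - p))^-1%:C *: (v - p).
have uw i : '[u i, w] = 0 by rewrite ipZr (on_residual on) mulr0.
exists (option I), (fun o => if o is Some i then u i else w); split.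
  move=> [i|] [j|] //=.
  - by rewrite (ip_eq0C (uw j)).
  - by rewrite ip_nm nmZ nm_real gtr0_norm ?invr_gt0// mulVf ?gt_eqF// expr1n.
move=> x h y; rewrite inE => /orP[/eqP ->|]; last by apply: hu => i; exact: (h (Some i)).
rewrite vp px ?addr0; last by move=> i; exact: (h (Some i)).
have := h None; rewrite ipZl => /eqP; rewrite mulf_eq0 => /orP[|/eqP//].
by rewrite conjC_real (inj_eq (@complexI R) _ 0) invr_eq0 gt_eqF.
Qed.

Context (B : {linear H -> H}) (B_bounded : bounded_operator B).

(** The unit ball is cut into cells by rounding its finitely many coordinates along u. Within a
    cell, x - y has a projection p with small coordinates, and a residual of norm at most 2 on which
    B is small. *)
Lemma small_tail_compact :
  (forall d : R, 0 < d -> exists s : seq H,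
     forall x, {in s, forall v, '[v, x] = 0} -> nm (B x) <= d * nm x) ->
  compact_operator B.
Proof.
move=> tail; have [M M0 hM] := bounded_operatorP B_bounded.
apply: finite_cells_precompact => d d0.
have d4 : 0 < d / 4 by rewrite divr_gt0.
have [s hs] := tail _ d4; have [I [u [on hu]]] := gram_schmidt s.
pose m : R := #|I|%:R.
have m0 : 0 <= m by rewrite ler0n.
(* With eta = d / (4 (m M + 1)) the projection contributes at most 2 m M eta <= d / 2; adding 1
   covers m = 0. *)
have mM : 0 < 4 * (m * M + 1) by rewrite mulr_gt0// ltr_wpDl ?mulr_ge0 ?(ltW M0).
have [K [cell hcell]] := @real_grid R _ (divr_gt0 d0 mM).
set eta := d / _ in hcell.
exists {ffun I -> 'I_K.+1 * 'I_K.+1}.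
exists (fun x => [ffun i => (cell (complex.Re '[u i, x]), cell (complex.Im '[u i, x]))]).
move=> x y; rewrite /= -!nmE !(lecR _ 1) => nx ny /ffunP e.
have co z i : nm z <= 1 -> nm '[u i, z] <= 1.
  by move=> nz; rewrite (le_trans (cauchy_schwarz _ _ _))// (orthonormal_nm i on) mul1r.
have close i : nm '[u i, x - y] <= 2 * eta.
  have := e i; rewrite !ffunE => -[/hcell h1 /hcell h2].
  rewrite ipBr (le_trans (nm_le_ReIm _))//.
  have -> : complex.Re ('[u i, x] - '[u i, y]) = complex.Re '[u i, x] - complex.Re '[u i, y].
    by case: '[u i, x] '[u i, y] => a b [].
  have -> : complex.Im ('[u i, x] - '[u i, y]) = complex.Im '[u i, x] - complex.Im '[u i, y].
    by case: '[u i, x] '[u i, y] => a b [].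
  have := h1 (le_trans (abs_Re_le_nm _) (co _ i nx)) (le_trans (abs_Re_le_nm _) (co _ i ny)).
  have := h2 (le_trans (abs_Im_le_nm _) (co _ i nx)) (le_trans (abs_Im_le_nm _) (co _ i ny)).
  by lra.
pose p := \sum_i '[u i, x - y] *: u i.
have res i : '[u i, (x - y) - p] = 0 by exact: (on_residual on).
have nres : nm ((x - y) - p) <= 2.
  have pr : '[p, (x - y) - p] = 0.
    by rewrite ip_suml big1// => i _; rewrite ipZl res mulr0.
  have := nm_pyth pr; rewrite addrC subrK => e2.
  have : nm (x - y) <= 2 by have := nmD x (- y); rewrite nmN; lra.
  apply: le_trans; rewrite -(ler_pXn2r (_ : 0 < 2)%N)// ?nnegrE ?nm_ge0//.
  by rewrite e2 lerDr sqr_ge0.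
have Bp : nm (B p) <= m * (2 * eta * M).
  rewrite /p linear_sum (le_trans (nm_sum _ _))//.
  rewrite /m mulr_natl -sumr_const ler_sum// => i _.
  rewrite linearZ nmZ ler_pM ?nm_ge0// (le_trans (hM _))// (orthonormal_nm i on) mulr1//.
have Br : nm (B ((x - y) - p)) <= d / 4 * 2.
  by rewrite (le_trans (hs _ (hu _ res)))// ler_pM2l.
have -> : B x - B y = B p + B ((x - y) - p) by rewrite -linearB -{1}[x - y](subrK p) linearD addrC.
have em : m * (2 * eta * M) <= d / 2.
  have -> : m * (2 * eta * M) = (m * M) / (m * M + 1) * (d / 2).
    rewrite /eta; field; lra.
  rewrite ler_piMl ?divr_ge0 ?(ltW d0)//.
  rewrite ler_pdivrMr ?mul1r ?lerDl//.
  by rewrite ltr_wpDl ?mulr_ge0 ?(ltW M0).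
have := nmD (B p) (B ((x - y) - p)); lra.
Qed.

Context (Bs : H -> H) (adj : is_adjoint ip B Bs).

(* A sequence of unit vectors x orthogonal to E that maximizes |B x|^2, with
   supremum sg, satisfies B^* B x - sg x -> 0; compactness of B gives a limit. *)
Lemma eigenvector_exists (E : set H) (x0 : H) : compact_operator B ->
  (forall v, E v -> exists c : C, Bs (B v) = c *: v) ->
  (forall v, E v -> '[v, x0] = 0) -> x0 != 0 ->
  exists z (c : C), [/\ nm z = 1, forall v, E v -> '[v, z] = 0 & Bs (B z) = c *: z].
Proof.
move=> cB eig Ex0 x00; have [M M0 hM] := bounded_operatorP B_bounded.
have hMs y : nm (Bs y) <= M * nm y by apply: (adjoint_bound adj); rewrite ?(ltW M0).
pose P x := forall v, E v -> '[v, x] = 0.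
have PZ a x : P x -> P (a *: x) by move=> h v Ev; rewrite ipZr h// mulr0.
(* The orthogonal complement of a set of eigenvectors is invariant under B^* B, so the maximization
   can stay inside it. *)
have PT x : P x -> P (Bs (B x)).
  move=> h v Ev; have [c hc] := eig v Ev.
  by rewrite -adj (adjoint_flip adj) hc ipZl h// mulr0.
have nx0 : 0 < nm x0 by rewrite nm_gt0.
pose x1 := (nm x0)^-1%:C *: x0.
have nx1 : nm x1 = 1 by rewrite nmZ nm_real gtr0_norm ?invr_gt0// mulVf ?gt_eqF.
have Px1 : P x1 by exact: PZ.
pose D := [set nm (B x) ^+ 2 | x in [set x | P x /\ nm x = 1]].
have hs : has_sup D.
  split; first by exists (nm (B x1) ^+ 2), x1.
  exists (M ^+ 2) => _ [x [_ nx] <-].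
  by rewrite ler_pXn2r ?nnegrE ?nm_ge0 ?(ltW M0)// (le_trans (hM _))// nx mulr1.
pose sg := sup D.
have ub x : P x -> nm x = 1 -> nm (B x) ^+ 2 <= sg.
  by move=> Px nx; apply: (sup_upper_bound hs); exists x.
have [sg0|sg0] := leP sg 0.
  exists x1, 0; split => //; have := le_trans (ub _ Px1 nx1) sg0 => h.
  have : nm (B x1) ^+ 2 == 0 by rewrite eq_le h sqr_ge0.
  by rewrite sqrf_eq0 nm_eq0 => /eqP ->; rewrite (adjoint0 adj) scale0r.
have ubh x : P x -> nm (B x) ^+ 2 <= sg * nm x ^+ 2.
  move=> Px; have [->|xn0] := eqVneq x 0; first by rewrite linear0 !nm0 expr0n mulr0.
  have nx : 0 < nm x by rewrite nm_gt0.
  have := ub ((nm x)^-1%:C *: x) (PZ _ _ Px).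
  rewrite linearZ !nmZ nm_real gtr0_norm ?invr_gt0// mulVf ?gt_eqF// => /(_ erefl).
  by rewrite exprMn exprVn mulrC ler_pdivrMr ?exprn_gt0.
(* The square expands to |B^* B x|^2 + sg^2 - 2 sg |B x|^2, and |B^* B x|^2 <= sg |B x|^2 comes from
   applying the supremum to B^* B x itself. *)
have gap x : P x -> nm x = 1 ->
    nm (Bs (B x) - sg%:C *: x) ^+ 2 <= sg * (sg - nm (B x) ^+ 2).
  move=> Px nx; pose w := Bs (B x).
  have hw : nm w ^+ 2 <= sg * nm (B x) ^+ 2.
    have [->|w0] := eqVneq w 0; first by rewrite nm0 expr0n mulr_ge0 ?sqr_ge0 ?(ltW sg0).
    have nw : 0 < nm w ^+ 2 by rewrite exprn_gt0// nm_gt0.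
    have : nm w ^+ 2 <= nm (B w) * nm (B x).
      have -> : nm w ^+ 2 = nm '[B w, B x].
        by rewrite adj ip_nm nm_real ger0_norm ?sqr_ge0.
      exact: cauchy_schwarz.
    rewrite -(ler_pXn2r (_ : 0 < 2)%N)// ?nnegrE ?mulr_ge0 ?nm_ge0 ?sqr_ge0// => k.
    rewrite -(ler_pM2l nw) -expr2 (le_trans k)// exprMn [leRHS]mulrA ler_wpM2r ?sqr_ge0//.
    by rewrite [leRHS]mulrC; exact: (ubh _ (PT _ Px)).
  rewrite -/w (nm_sqrD ip) nmN nmZ nm_real nx mulr1 ger0_norm ?(ltW sg0)//.
  have -> : complex.Re '[w, - (sg%:C *: x)] = - (sg * nm (B x) ^+ 2).
    rewrite ipNr ipZr -(adjoint_flip adj) ip_nm -rmorphM -rmorphN //.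
  by lra.
have hseq n : exists x, [/\ P x, nm x = 1 & sg - n.+1%:R^-1 < nm (B x) ^+ 2].
  have n0 : 0 < n.+1%:R^-1 :> R by rewrite invr_gt0 ltr0n.
  by have [_ [x [Px nx] <-] hx] := sup_adherent n0 hs; exists x.
have /choice[xs hxs] := hseq.
have [y [_ cy]] : closure (B @` [set f : H | `|f| <= 1]) `&`
    cluster ((fun n => B (xs n)) @ \oo) !=set0.
  move: cB; rewrite /compact_operator precompactE => cB; apply: cB.
  exists 0%N => // n _; apply: subset_closure; exists (xs n) => //=.
  by have [_ nx _] := hxs n; rewrite -nmE nx.
(* Where B x_n is close to y, sg x_n is close to B^* B x_n and hence to B^* y; this dictates the
   limit point z. *)
pose z := sg^-1%:C *: Bs y.
have approx d : 0 < d -> exists x, [/\ P x, nm x = 1, nm (x - z) < d &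
    nm (Bs (B x) - sg%:C *: x) < d].
  move=> d0.
  (* The residual must be below d itself, and below d / 2 after division by [sg]. *)
  pose d' := minr (d * sg / 2) d.
  have d'0 : 0 < d' by rewrite lt_min d0 divr_gt0 ?mulr_gt0.
  have q0 : 0 < d' ^+ 2 / sg by rewrite divr_gt0 ?exprn_gt0.
  pose N := Num.truncn (d' ^+ 2 / sg)^-1.
  have hN n : (N <= n)%N -> n.+1%:R^-1 < d' ^+ 2 / sg.
    move=> Nn; rewrite invf_plt ?posrE ?ltr0n//.
    have : (d' ^+ 2 / sg)^-1 < N.+1%:R by apply: truncnS_gt; rewrite invr_ge0 ltW.
    by move/lt_le_trans; apply; rewrite ler_nat.
  have dM : 0 < d * sg / (2 * M) by rewrite divr_gt0 ?mulr_gt0.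
  have [_ [[n Nn <-] yn]] : [set B (xs n) | n in [set n | (N <= n)%N]] `&`
      [set u | nm (y - u) < d * sg / (2 * M)] !=set0.
    apply: cy; first by exists N => // n Nn; exists n.
    by apply/nbhs_nm; exists (d * sg / (2 * M)).
  have [Px nx hx] := hxs n; exists (xs n).
  have g : nm (Bs (B (xs n)) - sg%:C *: xs n) < d'.
    rewrite -(ltr_pXn2r (_ : 0 < 2)%N)// ?nnegrE ?nm_ge0 ?(ltW d'0)//.
    rewrite (le_lt_trans (gap _ Px nx))// mulrC -ltr_pdivlMr//.
    by rewrite ltrBlDl -ltrBlDr (lt_trans _ hx)// ltrD2l ltrN2 hN.
  split => //; last by rewrite (lt_le_trans g)// ge_min lexx orbT.
  have -> : xs n - z = sg^-1%:C *: ((sg%:C *: xs n - Bs (B (xs n))) + Bs (B (xs n) - y)).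
    rewrite (adjointB adj) addrA subrK scalerBr scalerA -rmorphM mulVf ?gt_eqF//=.
    by rewrite scale1r.
  rewrite nmZ nm_real gtr0_norm ?invr_gt0// mulrC ltr_pdivrMr//.
  have hb : nm (Bs (B (xs n) - y)) < d * sg / 2.
    rewrite (le_lt_trans (hMs _))// nm_distC -ltr_pdivlMl// (lt_le_trans yn)//.
    by rewrite le_eqVlt; apply/orP; left; apply/eqP; field; rewrite gt_eqF.
  have ga : nm (sg%:C *: xs n - Bs (B (xs n))) < d * sg / 2.
    by rewrite nm_distC (lt_le_trans g)// ge_min lexx.
  have := nmD (sg%:C *: xs n - Bs (B (xs n))) (Bs (B (xs n) - y)); lra.
have small (a : R) (c : R) : 0 <= c -> (forall d, 0 < d -> a <= c * d) -> a <= 0.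
  move=> c0 h; apply/ler_addgt0Pr => d d0; rewrite add0r.
  have c1 : 0 < c + 1 by rewrite ltr_wpDl.
  rewrite (le_trans (h _ (divr_gt0 d0 c1)))// mulrA ler_pdivrMr// mulrC ler_pM2l//.
  by rewrite lerDl.
exists z, sg%:C; split.
- have h : `|nm z - 1| <= 0.
    apply: (small _ 1) => // d d0; have [x [_ nx xz _]] := approx d d0.
    rewrite mul1r ltW// (le_lt_trans _ xz)// -nx ler_norml.
    have := nmB_ge x z; have := nmB_ge z x; rewrite (nm_distC z x); lra.
  by apply/eqP; rewrite -subr_eq0 -normr_eq0 eq_le h normr_ge0.
- move=> v Ev; apply/eqP; rewrite -nm_eq0 eq_le nm_ge0 andbT.
  apply: (small _ (nm v)); rewrite ?nm_ge0// => d d0.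
  have [x [Px nx xz _]] := approx d d0.
  have -> : '[v, z] = - '[v, x - z] by rewrite ipBr Px// sub0r opprK.
  by rewrite nmN (le_trans (cauchy_schwarz _ _ _))// ler_wpM2l ?nm_ge0// ltW.
apply/eqP; rewrite -subr_eq0 -nm_eq0 eq_le nm_ge0 andbT.
(* The three summands belong to B^* B (x - z), the residual B^* B x - sg x, and sg (x - z). *)
apply: (small _ (M * M + 1 + sg)); first by rewrite !addr_ge0 ?mulr_ge0 ?(ltW M0) ?(ltW sg0).
move=> d d0; have [x [Px nx xz gx]] := approx d d0.
have -> : Bs (B z) - sg%:C *: z = - Bs (B (x - z)) + (Bs (B x) - sg%:C *: x) + sg%:C *: (x - z).
  have tel (a b c : H) : a - b + (b - c) = a - c by rewrite addrA subrK.
  have BB : B (x - z) = B x - B z by exact: linearB.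
  by rewrite BB (adjointB adj) scalerBr opprB !tel.
rewrite (le_trans (nmD _ _))// mulrDl lerD//.
  rewrite (le_trans (nmD _ _))// mulrDl lerD// ?mul1r ?(ltW gx)//.
  rewrite nmN (le_trans (hMs _))// -mulrA ler_wpM2l ?(ltW M0)//.
  by rewrite (le_trans (hM _))// ler_wpM2l ?(ltW M0)// ltW.
by rewrite nmZ nm_real gtr0_norm// ler_wpM2l ?(ltW sg0)// ltW.
Qed.

(** A maximal orthonormal set of eigenvectors of B^* B is complete, since a nonzero vector
    orthogonal to it would yield one more eigenvector. The set serves as its own index type, and the
    eigenvalue at v must be (v, B^* B v) = |B v|^2. *)
Lemma singular_system : compact_operator B ->
  exists (I : choiceType) (u : I -> H) (mu : I -> R),
    [/\ complete_orthonormal ip u, forall i, 0 <= mu i &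
        forall i, Bs (B (u i)) = (mu i ^+ 2)%:C *: u i].
Proof.
move=> cB.
pose Q (E : set H) := (forall v, E v -> nm v = 1 /\ exists c : C, Bs (B v) = c *: v) /\
  (forall v w, E v -> E w -> v != w -> '[v, w] = 0).
have [E [[E1 E2] Emax]] : exists E, Q E /\ forall E', E `<` E' -> ~ Q E'.
  apply: Zorn_bigcup => FF FQ Ftot; split.
    by move=> v [E FE Ev]; have [h _] := FQ _ FE; exact: h.
  move=> v w [E FE Ev] [E' FE' Ew].
  have [h|h] := Ftot _ _ FE FE'.
    by have [_ k] := FQ _ FE'; apply: k => //; exact: h.
  by have [_ k] := FQ _ FE; apply: k => //; exact: h.
exists {v : H | v \in E}, (fun i => val i), (fun i => nm (B (val i))).
have Ei (i : {v : H | v \in E}) : E (val i) by have := valP i; rewrite inE.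
split; last first.
- move=> i; have [n1 [c hc]] := E1 _ (Ei i); rewrite hc; congr (_ *: _).
  by rewrite -(ip_nm ip) adj hc ipZr ip_nm n1 expr1n mulr1.
- by move=> i; exact: nm_ge0.
split.
  move=> i j; have [->|ij] := eqVneq i j.
    by rewrite ip_nm; have [-> _] := E1 _ (Ei j); rewrite expr1n.
  by apply: E2.
move=> f hf; apply/eqP; apply: contraT => f0.
have Ef v : E v -> '[v, f] = 0.
  by move=> Ev; have vE : v \in E by [rewrite inE]; exact: (hf (exist _ v vE)).
have [z [c [nz Ez hz]]] := eigenvector_exists cB (fun v Ev => (E1 v Ev).2) Ef f0.
have zE : ~ E z.
  by move=> /Ez /eqP; rewrite ip_nm nz expr1n oner_eq0.
exfalso; apply: (Emax (E `|` [set z])).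
  split; first by move=> v; left.
  by move=> h; apply: zE; apply: h; right.
split.
  by move=> v [/E1//|->]; split => //; exists c.
move=> v w [Ev|->] [Ew|->] vw; [exact: E2|exact: Ez|exact/ip_eq0C/Ez|].
by rewrite eqxx in vw.
Qed.

End CompactOperators.

(** * Particle vectors, second quantization and Slater determinants *)

Section Fock.
Context {R : realType} {L F : completeNormedModType R[i]}.
Context (ipL : inner_product L) (J : L -> L) (J_conj : conjugation J).
Context (ipF : inner_product F) (a adag : L -> {linear F -> F}) (Om : F).
Context (fock : fock_representation ipL J ipF a adag Om).
Context (e : nat -> L) (e_cons : complete_orthonormal ipL e).
Local Notation C := R[i].
Local Notation "''[' u , v ]" := (inner ipL u v) : ring_scope.
Local Notation "''[' u , v ]_F" := (inner ipF u v) : ring_scope.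

Lemma a_J_adag f g Phi : a (J f) (adag g Phi) = '[f, g] *: Phi - adag g (a (J f) Phi).
Proof.
by apply/eqP; rewrite eq_sym subr_eq eq_sym (fock_car_ad fock) (conj_involutive J_conj).
Qed.

Lemma adag_flip f Phi Psi : '[Phi, adag f Psi]_F = '[a (J f) Phi, Psi]_F.
Proof. by rewrite (fock_adjoint fock) (conj_involutive J_conj). Qed.

Lemma adag_flipl f Phi Psi : '[adag f Phi, Psi]_F = '[Phi, a (J f) Psi]_F.
Proof. by rewrite ipC adag_flip -ipC. Qed.

(** The anticommutation relation gives |adag f Phi|^2 + |a (J f) Phi|^2 = |f|^2 |Phi|^2. *)
Lemma adag_nm f Phi : nm (adag f Phi) <= nm f * nm Phi.
Proof.
rewrite -(ler_pXn2r (_ : 0 < 2)%N)// ?nnegrE ?mulr_ge0 ?nm_ge0//.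
rewrite -lecR -(ip_nm ipF) adag_flip a_J_adag ipBl ipZl adag_flipl !ip_nm conjC_real.
by rewrite -rmorphM -rmorphB lecR exprMn lerBlDr lerDl sqr_ge0.
Qed.

Lemma adagP Phi c f g : adag (c *: f + g) Phi = c *: adag f Phi + adag g Phi.
Proof. exact: (fock_adag_linear fock Phi c f g). Qed.

Lemma adag0 Phi : adag 0 Phi = 0.
Proof. by have := adagP Phi (-1) 0 0; rewrite scaler0 addr0 scaleN1r addNr. Qed.

Lemma adag_sum n (c : 'I_n -> C) (f : 'I_n -> L) Phi :
  adag (\sum_j c j *: f j) Phi = \sum_j c j *: adag (f j) Phi.
Proof.
elim/big_rec2 : _ => [|j x y _ <-]; [exact: adag0 | exact: adagP].
Qed.

Lemma adagB f g Phi : adag (f - g) Phi = adag f Phi - adag g Phi.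
Proof. by rewrite addrC -scaleN1r adagP scaleN1r addrC. Qed.

Definition dGamma_part (B : L -> L) n (Phi : F) : F :=
  \sum_(j < n) adag (B (e j)) (a (J (e j)) Phi).

Lemma dGamma_partE (B : L -> L) Phi :
  dGamma J a adag e B Phi = lim ((fun n => dGamma_part B n Phi) @ \oo).
Proof.
rewrite /dGamma; congr (lim (_ @ \oo)); apply/funext => n.
by rewrite /series /= /dGamma_part big_mkord.
Qed.

(** Moving [adag f] to the left past an annihilator and a creator costs two signs, which cancel; the
    contractions assemble the projection of f onto the first n basis vectors. *)
Lemma dGamma_part_adag (B : {linear L -> L}) n f Phi :
  dGamma_part B n (adag f Phi) =
  adag (B (\sum_(j < n) '[e j, f] *: e j)) Phi + adag f (dGamma_part B n Phi).
Proof.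
have -> : B (\sum_(j < n) '[e j, f] *: e j) = \sum_(j < n) '[e j, f] *: B (e j).
  by rewrite linear_sum; apply: eq_bigr => j _; rewrite linearZ.
rewrite adag_sum.
rewrite /dGamma_part linear_sum -big_split; apply: eq_bigr => j _ /=.
rewrite a_J_adag linearB linearZ; congr (_ + _).
have /eqP := fock_car_dd fock (B (e j)) f (a (J (e j)) Phi).
by rewrite addr_eq0 => /eqP ->; rewrite opprK.
Qed.

Lemma dGamma_part_Om (B : L -> L) n : dGamma_part B n Om = 0.
Proof. by rewrite /dGamma_part big1// => j _; rewrite (fock_vacuum fock) linear0. Qed.

(* The commutator [dGamma B, adag f] = adag (B f), in the limit. *)
Lemma dGamma_part_cvg (B : {linear L -> L}) f Phi Psi : bounded_operator B ->
  (fun n => dGamma_part B n Phi) @ \oo --> Psi ->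
  (fun n => dGamma_part B n (adag f Phi)) @ \oo --> adag (B f) Phi + adag f Psi.
Proof.
move=> bB h; under eq_fun do rewrite dGamma_part_adag.
apply: cvgD; last exact: (bounded_cvg (fock_adag_bounded fock f) h).
apply/cvg_nm => d d0.
have [e_on e_co] := e_cons.
have /cvg_nm hf := bounded_cvg bB (on_expand e_on e_co (f := f)).
have p1 : 0 < nm Phi + 1 by rewrite ltr_wpDl ?nm_ge0.
have [N hN] := hf _ (divr_gt0 d0 p1).
exists N => n Nn.
rewrite -adagB (le_lt_trans (adag_nm _ _))//.
rewrite (@le_lt_trans _ _ (nm (B (\sum_(i < n) '[e i, f] *: e i) - B f) * (nm Phi + 1)))//.
  by rewrite ler_wpM2l ?nm_ge0// lerDl.
by rewrite -ltr_pdivlMr// hN.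
Qed.

Definition particle (fs : seq L) : F := foldr (fun f => adag f) Om fs.

(** The Leibniz rule: [dGamma B] acts as a derivation on products of creators and annihilates the
    vacuum. *)
Fixpoint dGamma_val (B : L -> L) (fs : seq L) : F :=
  if fs is f :: fs' then adag (B f) (particle fs') + adag f (dGamma_val B fs') else 0.

Lemma dGamma_particle_cvg (B : {linear L -> L}) fs : bounded_operator B ->
  (fun n => dGamma_part B n (particle fs)) @ \oo --> dGamma_val B fs.
Proof.
move=> bB; elim: fs => [|f fs IH]; last exact: dGamma_part_cvg.
under eq_fun do rewrite dGamma_part_Om.
exact: cvg_cst.
Qed.

Lemma dGamma_particle (B : {linear L -> L}) fs : bounded_operator B ->
  dGamma J a adag e B (particle fs) = dGamma_val B fs.
Proof.
by move=> bB; rewrite dGamma_partE; apply: cvg_lim => //; exact: dGamma_particle_cvg.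
Qed.

Lemma dGamma_val_id fs : dGamma_val id fs = (size fs)%:R *: particle fs.
Proof.
elim: fs => [|f fs IH] /=; first by rewrite scale0r.
by rewrite IH linearZ -[X in X + _]scale1r -scalerDl -nat1r.
Qed.

Lemma number_particle_cvg fs :
  (fun n => dGamma_part id n (particle fs)) @ \oo --> ((size fs)%:R : C) *: particle fs.
Proof.
rewrite -dGamma_val_id.
have bid : bounded_operator (idfun : {linear L -> L}).
  by apply/linear_bounded_continuous => x; exact: cvg_id.
exact: (@dGamma_particle_cvg (idfun : {linear L -> L})).
Qed.

(* dGamma 1 is symmetric and its eigenvalue on a particle vector is the number
   of particles. *)
Lemma particle_orthogonal fs gs : size fs != size gs ->
  '[particle fs, particle gs]_F = 0.
Proof.
move=> ne.
have sym n Phi Psi : '[Phi, dGamma_part id n Psi]_F = '[dGamma_part id n Phi, Psi]_F.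
  by rewrite ip_sumr ip_suml; apply: eq_bigr => j _; rewrite adag_flip adag_flipl.
have : ((size gs)%:R : C) * '[particle fs, particle gs]_F =
    ((size fs)%:R : C) * '[particle fs, particle gs]_F.
  rewrite -ipZr.
  have -> : ((size fs)%:R : C) * '[particle fs, particle gs]_F =
      '[((size fs)%:R : C) *: particle fs, particle gs]_F.
    by rewrite ipZl rmorph_nat.
  have h1 := @number_particle_cvg gs; have h2 := @number_particle_cvg fs.
  (* By [sym] one and the same number, the matrix element of the n-th partial sum between the two
     particle vectors, tends to both sides. *)
  apply: nm_small_eq => d d0; have d2 : 0 < d / 2 by rewrite divr_gt0.
  have [N hN] := ip_cvg ipF (particle fs) h1 d2.
  have [N' hN'] := ip_cvg ipF (particle gs) h2 d2.
  have := hN _ (leq_maxl N N'); have := hN' _ (leq_maxr N N').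
  rewrite -nm_conj rmorphB /= -!ipC -sym => k k'.
  set x := '[particle fs, dGamma_part _ _ _]_F in k k'.
  rewrite -[X in nm (X - _)](subrK x) -addrA (le_lt_trans (nmD _ _))//.
  by rewrite [ltRHS]splitr ltrD// nm_distC.
move/eqP; rewrite -subr_eq0 -mulrBl mulf_eq0 subr_eq0 eqr_nat eq_sym (negbTE ne) /=.
by move/eqP.
Qed.

Lemma span_orth (A : set F) (Phi Psi : F) :
  (forall v, A v -> '[Phi, v]_F = 0) -> linear_span A Psi -> '[Phi, Psi]_F = 0.
Proof.
move=> h [n [c [v [Av ->]]]]; rewrite ip_sumr big1// => i _.
by rewrite ipZr h ?mulr0.
Qed.

Lemma closure_orth (A : set F) (Phi Psi : F) :
  (forall v, A v -> '[Phi, v]_F = 0) -> closure A Psi -> '[Phi, Psi]_F = 0.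
Proof.
move=> h /closure_nm cl; apply: nm_small_eq => d d0; rewrite subr0.
have p1 : 0 < nm Phi + 1 by rewrite ltr_wpDl ?nm_ge0.
have [y Ay yd] := cl _ (divr_gt0 d0 p1).
have -> : '[Phi, Psi]_F = '[Phi, Psi - y]_F by rewrite ipBr (h _ Ay) subr0.
rewrite (le_lt_trans (cauchy_schwarz _ _ _))//.
rewrite (@le_lt_trans _ _ ((nm Phi + 1) * nm (Psi - y)))//.
  by rewrite ler_wpM2r ?nm_ge0// lerDl.
by rewrite mulrC -ltr_pdivlMr.
Qed.

Lemma particle_space_orth fs n Psi : size fs != n ->
  particle_space adag Om n Psi -> '[particle fs, Psi]_F = 0.
Proof.
move=> ne; apply: closure_orth => v; apply: span_orth => {}v [gs ->].
by apply: particle_orthogonal; rewrite size_tuple.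
Qed.

Lemma span_mem (A : set F) v : A v -> linear_span A v.
Proof.
move=> Av; exists 1%N, (fun=> 1), (fun=> v); split => //.
by rewrite big_ord1 scale1r.
Qed.

Lemma span_zero (A : set F) : linear_span A 0.
Proof. by exists 0%N, (fun=> 0), (fun=> 0); split => [[]//|]; rewrite big_ord0. Qed.

Lemma particle_mem fs : particle_space adag Om (size fs) (particle fs).
Proof. by apply: subset_closure; apply: span_mem; exists (in_tuple fs). Qed.

Lemma particle_finite fs : finite_particle adag Om (particle fs).
Proof. by apply: span_mem; exists (size fs) => //; exact: particle_mem. Qed.

(* All decompositions allowed by number_power have the same scalar products
   with Phi, so the choice made by xget does not matter. *)
Lemma number_power_particle s fs :
  '[particle fs, number_power adag Om s (particle fs)]_F =
  (((size fs)%:R : R) `^ s * nm (particle fs) ^+ 2)%:C.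
Proof.
rewrite /number_power; set Q := [set Psi | _]; set Phi := particle fs.
have : Q (xget 0 Q).
  (* A single component in degree [size fs] shows that the set is nonempty, so [xget] does not
     return its default 0. *)
  apply: xgetPex; exists (((size fs)%:R `^ s)%:C *: Phi).
  exists (size fs).+1, (fun n => if n == size fs then Phi else 0); split.
  - move=> n; case: eqP => [->|_]; first exact: particle_mem.
    by apply: subset_closure; exact: span_zero.
  - rewrite big_ord_recr /= eqxx big1 ?add0r// => i _.
    by rewrite ltn_eqF.
  - rewrite big_ord_recr /= eqxx big1 ?add0r// => i _.
    by rewrite ltn_eqF// scaler0.
move=> [m [phi [hphi eP ->]]].
have o n : n != size fs -> '[Phi, phi n]_F = 0.
  by rewrite eq_sym => ne; apply: particle_space_orth (hphi n).
have -> : ((size fs)%:R `^ s * nm Phi ^+ 2)%:C = ((size fs)%:R `^ s)%:C * '[Phi, Phi]_F.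
  by rewrite ip_nm -rmorphM.
(* Expanding only the right factor allows a comparison degree by degree; degrees other than
   [size fs] contribute 0. *)
have -> : '[Phi, Phi]_F = \sum_(n < m) '[Phi, phi n]_F by rewrite {2}/Phi eP ip_sumr.
rewrite ip_sumr mulr_sumr.
apply: eq_bigr => n _; rewrite ipZr.
by have [<-//|ne] := eqVneq (n : nat) (size fs); rewrite o ?mulr0.
Qed.

Lemma a_particle_orth f fs : {in fs, forall g, '[f, g] = 0} ->
  a (J f) (particle fs) = 0.
Proof.
elim: fs => [|g fs IH] h /=; first exact: (fock_vacuum fock).
rewrite a_J_adag h ?mem_head// scale0r IH.
  by rewrite (linear0 (adag g)) subr0.
by move=> x xs; rewrite h// inE xs orbT.
Qed.

(** Induction along the enumeration: the annihilator adjoint to the newest creator kills the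
    remaining determinant, so only the contractions (f_i, f_i) and (f_i, B f_i) survive. *)
Lemma slater n (f : 'I_n -> L) (B : {linear L -> L}) : orthonormal_family ipL f ->
  let Phi := particle [seq f i | i <- enum 'I_n] in
  nm Phi = 1 /\ '[Phi, dGamma_val B [seq f i | i <- enum 'I_n]]_F = \sum_i '[f i, B (f i)].
Proof.
move=> on.
rewrite (_ : \sum_i _ = \sum_(i <- enum 'I_n) '[f i, B (f i)]); last by rewrite big_enum.
elim: (enum 'I_n) (enum_uniq 'I_n) => [_|i s IH] /=.
  by rewrite big_nil ip0r /nm (fock_vacuum_unit fock).
move=> /andP[is_ us]; have {IH us} [n1 IH] := IH us.
have ao : a (J (f i)) (particle [seq f i | i <- s]) = 0.
  apply: a_particle_orth => g; elim: s is_ {n1 IH} => [|j s IH]; first by rewrite in_nil.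
  rewrite !inE negb_or => /andP[ij is_] /orP[/eqP ->|]; last exact: IH.
  by rewrite on (negbTE ij).
have fi1 : '[f i, f i] = 1 by rewrite on eqxx.
split.
  have : nm (adag (f i) (particle [seq f i | i <- s])) ^+ 2 = 1.
    apply: complexI; rewrite -(ip_nm ipF) adag_flip a_J_adag ao linear0 subr0 fi1 scale1r.
    by rewrite ip_nm n1 expr1n.
  move/eqP; rewrite sqrf_eq1 => /orP[/eqP//|/eqP k].
  by have := nm_ge0 (adag (f i) (particle [seq f i | i <- s])); rewrite k ler0N1.
rewrite big_cons -IH ipDr !adag_flipl !a_J_adag ao linear0 subr0 ipZr ip_nm n1 expr1n mulr1.
(* The operator [a (J (f i))] need not kill [dGamma_val] of the tail, as B f_j may overlap f_i; the
   term vanishes because [adag (f i)] moves to the left factor as [a (J (f i))] and kills the tail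
   determinant. *)
congr (_ + _); rewrite fi1 scale1r ipBr adag_flip ao ip0l subr0 //.
Qed.

End Fock.

(** * From bounded diagonal sums to the Schatten class *)

Section SchattenClass.
Context {R : realType} {H : completeNormedModType R[i]} (ip : inner_product H).
Local Notation "''[' u , v ]" := (inner ip u v) : ring_scope.

Lemma schatten_of_quadratic_bound (e : nat -> H) (B : {linear H -> H}) (K r p : R) :
  complete_orthonormal ip e -> bounded_operator B -> 0 <= K -> 1 <= r ->
  (forall n (f : 'I_n -> H), orthonormal_family ip f ->
     nm (\sum_i '[f i, B (f i)]) <= K * n%:R `^ (1 - r^-1)) ->
  (r = 1 /\ p = 1) \/ r < p -> schatten_class ip p B.
Proof.
move=> [e_on e_co] bB K0 r1 quad rp.
have [Bs adj] := adjoint_exists e_on e_co bB.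
have [h on_h greedy] := greedy_sequence bB e_on.
have alpha0 : 0 <= 1 - r^-1 by rewrite subr_ge0 invf_le1// (lt_le_trans _ r1).
have p0 : 0 < p by case: rp => [[_ ->]//|]; lra.
have [M hM] := tau_summable on_h greedy K0 alpha0 quad r1 erefl rp.
pose t n := nm '[h n, B (h n)].
have cB : compact_operator B.
  apply: (small_tail_compact (ip := ip)) => // d d0.
  (* Otherwise N terms of the bounded sum would each be at least d^p, which is impossible for N > M
     / d^p. *)
  have [n hn] : exists n, 4 * t n <= d.
    apply: contrapT => /forallNP big.
    have dp : 0 < d `^ p by exact: powR_gt0.
    pose N := (Num.truncn (M / d `^ p)).+1.
    have : M < N%:R * d `^ p by rewrite -ltr_pdivrMr// truncnS_gt.
    apply/negP; rewrite -leNgt (le_trans _ (hM N))// mulr_natl -[N in _ *+ N]card_ord -sumr_const.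
    apply: ler_sum => k _; rewrite ge0_ler_powR ?nnegrE ?mulr_ge0 ?nm_ge0 ?(ltW d0) ?(ltW p0)//.
    by rewrite leNgt; apply/negP => /ltW; exact: big.
  exists ([seq h i | i <- iota 0 n] ++ [seq Bs (h i) | i <- iota 0 n]) => x hx.
  rewrite (@le_trans _ _ (4 * t n * nm x))// ?ler_wpM2r ?nm_ge0//.
  apply: (tail_bound adj greedy) => i ni; apply: hx.
    by rewrite mem_cat map_f// mem_iota.
  by rewrite mem_cat [X in _ || X](@map_f _ _ (fun i => Bs (h i))) ?orbT// mem_iota.
split => //.
have [I [u [mu [u_co mu0 hmu]]]] := singular_system bB adj cB.
exists I, mu; split; first by exists u, Bs.
apply: (@le_lt_trans _ _ M%:E); last exact: ltry.
apply: ge_ereal_sup => _ [A [finA _] <-].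
rewrite fsbig_finite//= sumEFin lee_fin.
move: (finmap.enum_fset _) (finmap.fset_uniq (fset_set A)) => sA sA_uniq.
apply: le_trans (hM (size sA)).
apply: (sum_powR_le (tau := fun k => 4 * t k./2)) => //; first exact: ltW.
move=> k g gI.
(* [minmax] with n = k./2 takes 2n + 1 <= k + 1 indices, so g is restricted to an initial
   segment. *)
have kk : ((k./2).*2.+1 <= k.+1)%N by rewrite ltnS -[leqRHS]odd_double_half leq_addl.
have [|j hj] := minmax adj greedy (n := k./2) (g := g \o widen_ord kk) u_co.1 mu0 hmu
  (inj_comp gI _).
  by move=> i1 i2 /(congr1 val) /=; exact: val_inj.
by exists (widen_ord kk j).
Qed.

End SchattenClass.

Theorem theorem4p1 (R : realType)
  (L : completeNormedModType R[i]) (ipL : inner_product L)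
  (L_separable : separable_space L) (L_infinite : infinite_dimensional L)
  (J : L -> L) (J_conj : conjugation J)
  (F : completeNormedModType R[i]) (ipF : inner_product F)
  (a adag : L -> {linear F -> F}) (Om : F)
  (fock : fock_representation ipL J ipF a adag Om)
  (e : nat -> L) (e_cons : complete_orthonormal ipL e)
  (B : {linear L -> L}) (B_bounded : bounded_operator B)
  (r s : R) (r_ge1 : 1 <= r) (s_def : s = 2 * (r - 1) / r)
  (gamma delta : R)
  (dGamma_bound : forall Phi : F, finite_particle adag Om Phi ->
     `|dGamma J a adag e B Phi| ^+ 2 <=
     inner ipF Phi
       (gamma%:C *: number_power adag Om s Phi + delta%:C *: Phi)) :
  (s = 0 -> schatten_class ipL 1 B) /\
  (0 < s < 2 -> forall eps : R, 0 < eps -> schatten_class ipL (r + eps) B).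
Proof.
have r0 : 0 < r by lra.
have s2 : s = (1 - r^-1) * 2 by rewrite s_def; field; rewrite gt_eqF.
have s_ge0 : 0 <= s by rewrite s2 mulr_ge0// subr_ge0 invf_le1.
(* For n >= 1 one has n^s >= 1, so delta is absorbed into n^s; absolute values are taken since gamma
   and delta may be negative. *)
pose K := Num.sqrt (`|gamma| + `|delta|).
have quad n (f : 'I_n -> L) : orthonormal_family ipL f ->
    nm (\sum_i inner ipL (f i) (B (f i))) <= K * n%:R `^ (1 - r^-1).
  (* The empty family is treated apart because n^s >= 1 can fail for n = 0. *)
  move=> on; case: n f on => [|n] f on.
    by rewrite big_ord0 nm0 mulr_ge0 ?sqrtr_ge0 ?powR_ge0.
  have [n1 hq] := slater J_conj fock B on.
  set fs := [seq f i | i <- enum _] in n1 hq.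
  have fs_size : size fs = n.+1 by rewrite size_map size_enum_ord.
  have := dGamma_bound _ (particle_finite adag Om fs).
  rewrite (dGamma_particle J_conj fock e_cons fs B_bounded) ipDr !ipZr.
  rewrite (number_power_particle J_conj fock e_cons) ip_nm n1 expr1n fs_size !mulr1.
  rewrite -nmE -rmorphXn -rmorphM -rmorphD lecR => bnd.
  have ns : 1 <= n.+1%:R `^ s :> R.
    have : 1 `^ s <= n.+1%:R `^ s :> R by rewrite ge0_ler_powR ?nnegrE ?ler0n// ler1n.
    by rewrite powR1.
  rewrite -hq (le_trans (cauchy_schwarz _ _ _))// n1 mul1r.
  rewrite -(ler_pXn2r (_ : 0 < 2)%N)// ?nnegrE ?nm_ge0 ?mulr_ge0 ?sqrtr_ge0 ?powR_ge0//.
  have -> : (K * n.+1%:R `^ (1 - r^-1)) ^+ 2 = (`|gamma| + `|delta|) * n.+1%:R `^ s.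
    by rewrite exprMn sqr_sqrtr ?addr_ge0// s2 powRrM powR_mulrn ?powR_ge0.
  rewrite (le_trans bnd)// mulrDl lerD//.
    by rewrite ler_wpM2r ?ler_norm// powR_ge0.
  by rewrite (le_trans (ler_norm _))// ler_peMr.
have main p : (r = 1 /\ p = 1) \/ r < p -> schatten_class ipL p B.
  exact: (schatten_of_quadratic_bound e_cons B_bounded (sqrtr_ge0 _) r_ge1 quad).
split => [s0|_ eps eps0]; last by apply: main; right; rewrite ltrDl.
apply: main; left; split => //.
move: s0; rewrite s_def => /eqP; rewrite mulf_eq0 invr_eq0 (gt_eqF r0) orbF.
by rewrite mulf_eq0 pnatr_eq0 /= subr_eq0 => /eqP.
Qed.
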